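(* Let $p\in(1,\infty)$ and let $\mu_0,\mu_1$ be finite positive Borel measures on $\mathbb{R}$ supported on the intervals $\Delta_0,\Delta_1\subset\mathbb{R}$ respectively, where $\Delta_0$ does not reduce to a point, such that $\mathring{\Delta}_0\cap\mathring{\Delta}_1=\emptyset$ (and, if $\Delta_1$ reduces to a single point, this point does not belong to $\mathring{\Delta}_0$). Let $L_n$ be the $n$th monic extremal polynomial relative to the Sobolev norm $\|f\|_{S,p}=\left(\int_{\Delta_0}|f|^p\,d\mu_0+\int_{\Delta_1}|f'|^p\,d\mu_1\right)^{1/p}$. Then: 1. For all $n\ge 1$, $n-1\le \mathbf{N}_{\rm o}(L_n;\mathring{\Delta}_0)+\mathbf{N}_{\rm o}(L_n';\mathring{\Delta}_1)\le n$, and the zeros of $L_n$ in $\mathring{\Delta}_0$ are simple. 2. For all $n\ge 2$, the critical points of $L_n$ (the zeros of $L_n'$) are simple and contained in the interior of the convex hull of $\Delta_0\cup\Delta_1$. 3. The number of zeros of $L_n$ lying in $\mathring{C}\setminus(\mathring{\Delta}_0\cup\mathring{\Delta}_1)$ is at most one, and likewise the number of critical points of $L_n$ lying in this set is at most one, where $\mathring{C}$ denotes the interior of the convex hull of $\Delta_0\cup\Delta_1$. 4. The zeros of $L_n'$ in $\mathring{\Delta}_0$ interlace the zeros of $L_n$ in $\mathring{\Delta}_0$.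
   Context: $\mathring{A}$ denotes the interior of $A\subset\mathbb{R}$ in the Euclidean topology of $\mathbb{R}$; convex hulls are taken in $\mathbb{R}$. ''Supported on $\Delta_k$'' means that the support of $\mu_k$ is contained in $\Delta_k$ (a closed interval). Standing assumptions: the support of $\mu_0$ is an infinite set, and all polynomials belong to $L^p(\mu_0)$ and $L^p(\mu_1)$ (automatic when the supports are compact). The $n$th monic extremal polynomial $L_n$ is the unique monic polynomial of exact degree $n$ (complex coefficients being allowed a priori) that minimizes $\|Q\|_{S,p}$ over all monic polynomials $Q$ of degree $n$; it exists, is unique, and has real coefficients. For a polynomial $Q$ with real coefficients and an interval $I\subset\mathbb{R}$, $\mathbf{N}_{\rm o}(Q;I)$ is the number of distinct zeros of $Q$ in $I$ having odd multiplicity (i.e. points of $I$ where $Q$ changes sign). Interlacing on $\mathring{\Delta}_0$ means: between any two consecutive zeros of $L_n$ in $\mathring{\Delta}_0$ there is exactly one zero of $L_n'$, and between any two consecutive zeros of $L_n'$ in $\mathring{\Delta}_0$ there is exactly one zero of $L_n$. *)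

(* Defs.v *)
From HB Require Import structures.
From mathcomp Require Export all_boot all_order all_algebra.
From mathcomp Require Export finmap complex.
From mathcomp Require Export all_classical all_reals all_analysis.
Export Order.TTheory GRing.Theory Num.Theory numFieldNormedType.Exports.

Set Implicit Arguments.
Unset Strict Implicit.
Unset Printing Implicit Defensive.

Local Open Scope classical_set_scope.
Local Open Scope complex_scope.
Local Open Scope ring_scope.

Definition msupport (R : realType)
    (mu : {finite_measure set (measurableTypeR R) -> \bar R}) : set R :=
  [set x | forall U : set R, open U -> U x -> (0 < mu U)%E].

Definition convex_hull (R : realType) (A : set R) : set R :=
  smallest (@convex_set R R^o) A.

Definition complexify (R : realType) (Q : {poly R}) : {poly R[i]} :=
  map_poly (real_complex R) Q.

Definition sobolev_norm (R : realType) (p : R)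
    (mu0 mu1 : {finite_measure set (measurableTypeR R) -> \bar R})
    (D0 D1 : set R) (Q : {poly R[i]}) : \bar R :=
  ((\int[mu0]_(x in D0) (ComplexField.Normc.normc Q.[x%:C] `^ p)%:E
    + \int[mu1]_(x in D1) (ComplexField.Normc.normc Q^`().[x%:C] `^ p)%:E)
   `^ p^-1)%E.

(* Competitors may have complex coefficients, although the minimizer itself
   is real. *)
Definition monic_extremal (R : realType) (p : R)
    (mu0 mu1 : {finite_measure set (measurableTypeR R) -> \bar R})
    (D0 D1 : set R) (n : nat) (L : {poly R}) : Prop :=
  [/\ L \is monic, size L = n.+1 &
   forall Q : {poly R[i]}, Q \is monic -> size Q = n.+1 ->
     (sobolev_norm p mu0 mu1 D0 D1 (complexify L)
       <= sobolev_norm p mu0 mu1 D0 D1 Q)%E].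

(* For Q != 0 an odd multiplicity is positive, hence x is then a zero of Q;
   the cardinal is meaningful because Q has finitely many zeros. *)
Definition num_odd_zeros (R : realType) (Q : {poly R}) (I : set R) : nat :=
  #|` fset_set [set x | I x /\ odd (mup x Q)] |%fset.

(* Zeros are counted with multiplicity; the sum has finite support when
   Q != 0. *)
Definition num_zeros (R : realType) (Q : {poly R}) (A : set R) : nat :=
  \big[addn/0%N]_(x \in A) mup x Q.

Definition consecutive_zeros (R : realType) (Q : {poly R}) (I : set R)
    (x y : R) : Prop :=
  [/\ I x, I y, x < y, root Q x & root Q y] /\
  forall z, I z -> x < z < y -> ~~ root Q z.

Definition interlace (R : realType) (P Q : {poly R}) (I : set R) : Prop :=
  (forall x y, consecutive_zeros P I x y ->
     exists! z, x < z < y /\ root Q z) /\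
  (forall x y, consecutive_zeros Q I x y ->
     exists! z, x < z < y /\ root P z).

(* Main.v *)
(* First-order optimality: no nonzero real q of degree < n can satisfy q L >= 0 on
   D0 and q' L' >= 0 on D1, since otherwise L - e q would have a smaller norm for
   small e > 0.  Applied to a q whose zeros in the interior of D0 and whose
   critical points in the interior of D1 are the sign changes of L and of L' there
   (such a q exists by linear algebra, and Rolle's theorem leaves it no other zeros
   and critical points), this gives the lower bound n - 1.  Rolle's theorem then
   places all critical points of L but at most one, and the same q shows that the
   remaining one lies between D0 and D1.  Everything else is counting against
   deg L' = n - 1. *)
Require Import Defs.
From mathcomp Require Import polyrcf polyorder measurable_realfun ring lra zify.

Set Implicit Arguments.
Unset Strict Implicit.
Unset Printing Implicit Defensive.

Local Open Scope classical_set_scope.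
Local Open Scope complex_scope.
Local Open Scope ring_scope.

(** * Sign changes, Rolle's theorem and test polynomials over a real closed field *)

Section RealPoly.
Variable R : rcfType.
Implicit Types (P Q q : {poly R}) (a b c u v x y z : R) (T Z W s : seq R).

(** The two sign conditions on a test polynomial [q] cannot be normalized independently: the choice
    between [q] and [- q] is spent on [q L >= 0] over [D0], and the sign of [q' L'] over [D1] is
    then forced. It is found by transport. At a common simple zero [x] in [D0] the relative sign of
    two derivatives is known from the sign of the product of the polynomials; from [x] to a point
    [t] of [D1] each derivative changes sign according to its zeros between [x] and [t]. This is why
    the derivative of a test polynomial must be known as a full product of linear factors, and why
    [x] is taken facing [D1], where no Rolle zero intervenes. Reversing a wrong sign requires one
    more prescribed critical point, hence one more degree: the lower bound is n - 1 and not n. *)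

Lemma mup_gt0 P x : P != 0 -> (0 < mup x P)%N = root P x.
Proof. by move=> P0; rewrite -XsubC_dvd // dvdp_XsubCl. Qed.

Lemma mup_deriv P x : P != 0 -> root P x -> mup x P = (mup x P^`()).+1.
Proof.
have mupE Q : Q != 0 -> mup x Q = multiplicity x Q.
  move=> Q0; apply/eqP; rewrite eqn_leq -root_le_mu // -mup_geq // leqnn.
  by rewrite mup_geq // root_le_mu // leqnn.
move=> P0 rx; rewrite mupE // (mu_deriv_root P0 rx) addn1 mupE //.
rewrite -size_poly_eq0 size_deriv -subn1 subn_eq0 -ltnNge.
by rewrite (@root_size_gt1 _ x).
Qed.

(** Induction on the size: if the root given by the intermediate value theorem has even
    multiplicity, its factor is nonnegative and can be divided out without losing the opposite signs
    at [u] and [v]. *)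
Lemma odd_root_between P u v : u < v -> P.[u] * P.[v] < 0 ->
  exists2 c, u < c < v & odd (mup c P).
Proof.
move=> uv; have [k] := ubnP (size P); elim: k P => // k IH P sP Puv.
have P0 : P != 0 by apply: contraTneq Puv => ->; rewrite !horner0 mul0r ltxx.
have [c cuv rc] := poly_ivtoo (ltW uv) Puv.
have cuv' : u < c < v by rewrite !(itvP cuv).
have [od|ev] := boolP (odd (mup c P)); first by exists c.
have [m [Q Qc defP]] := multiplicity_XsubC P c; rewrite P0 /= in Qc.
have mE : mup c P = m by rewrite defP mupMr // mup_XsubCX eqxx.
have m0 : (0 < m)%N by rewrite -mE mup_gt0.
rewrite mE in ev.
have pow_ge0 t : 0 <= (t - c) ^+ m.
  by rewrite -(odd_double_half m) (negbTE ev) add0n -mul2n exprM exprn_ge0 ?sqr_ge0.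
have Quv : Q.[u] * Q.[v] < 0.
  move: Puv; rewrite defP !hornerM !horner_exp !hornerXsubC mulrACA.
  by apply: contraTT; rewrite -!leNgt => Quv; apply: mulr_ge0 => //; apply: mulr_ge0.
have sQ : (size Q < k)%N.
  rewrite -ltnS; apply: leq_trans sP; rewrite ltnS defP size_Mmonic ?monic_exp
      ?monicXsubC //.
    by rewrite size_exp_XsubC addnS /= -[X in (X < _)%N]addn0 ltn_add2l.
  by apply: contraNneq Qc => ->; rewrite root0.
have [d duv od] := IH Q sQ Quv; exists d => //.
have Q0 : Q != 0 by apply: contraNneq Qc => ->; rewrite root0.
rewrite defP mupM ?expf_neq0 ?polyXsubC_eq0 // mup_XsubCX.
case: eqP => [cd|_]; last by rewrite addn0.
by move: od; rewrite -cd mupNroot.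
Qed.

Lemma nonroot_between P a b : P != 0 -> a < b -> exists2 t, a < t < b & P.[t] != 0.
Proof.
(* These are [size P] distinct points, more than the degree allows as roots; the offset 2 in the
   denominator keeps [f 0] strictly below [b]. *)
move=> P0 ab; pose f k : R := a + (b - a) / k.+2%:R.
pose s := [seq f k | k <- iota 0 (size P)].
have f_inj : injective f.
  have ba0 : b - a != 0 by rewrite subr_eq0 gt_eqF.
  move=> i j /addrI /(mulfI ba0) /invr_inj /eqP.
  by rewrite eqr_nat !eqSS => /eqP.
have /allPn[t /mapP[k _ ->]] : ~~ all (root P) s.
  apply/negP => /(max_poly_roots P0) /(_ _); rewrite map_inj_uniq ?iota_uniq //.
  by move=> /(_ isT); rewrite size_map size_iota ltnn.
move=> rk; exists (f k); last exact: rk.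
rewrite /f ltrDl divr_gt0 ?subr_gt0 //=.
rewrite -ltrBrDl ltr_pdivrMr // ltr_pMr ?subr_gt0 //.
by rewrite ltr1n.
Qed.

(** At a point [t] where [P] does not vanish, the mean slopes on the two sides are opposite, so the
    derivative changes sign. Parity arguments later need this odd multiplicity, not just a root. *)
Lemma rolle_odd P a b : P != 0 -> a < b -> root P a -> root P b ->
  exists2 c, a < c < b & odd (mup c P^`()).
Proof.
move=> P0 ab /eqP ra /eqP rb; have [t /andP[at_ tb] Pt] := nonroot_between P0 ab.
have [c cat /esym c1] := poly_mvt P at_; have [d dtb /esym d1] := poly_mvt P tb.
have/andP[? ?] : a < c < t by rewrite !(itvP cat).
have/andP[? ?] : t < d < b by rewrite !(itvP dtb).
have neg : P^`().[c] * P^`().[d] < 0.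
  have : (P^`().[c] * P^`().[d]) * ((t - a) * (b - t)) < 0.
    rewrite mulrACA c1 d1 ra rb subr0 sub0r mulrN oppr_lt0 -expr2.
    by rewrite exprn_even_gt0.
  by rewrite pmulr_llt0 // mulr_gt0 // subr_gt0.
have cd : c < d by lra.
have [e /andP[? ?] od] := odd_root_between cd neg; exists e => //.
by apply/andP; split; lra.
Qed.

Lemma odd_mup_root P x : odd (mup x P) -> root P x.
Proof. by apply: contraTT => /mupNroot ->. Qed.

(** The brackets without entries of [T] inside, and the entries of [T] separating any two points of
    [Z], are what the interlacing will rest on. *)
Lemma rolle_seq P T : P != 0 -> sorted <%R T -> all (root P) T ->
  exists Z, [/\ size Z = (size T).-1, uniq Z,
    {in Z, forall z, odd (mup z P^`()) /\ exists a b, [/\ a \in T, b \in T,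
       a < z < b & {in T, forall t, ~~ (a < t < b)}]}
   & {in Z &, forall y z, y < z -> exists2 t, t \in T & y < t < z}].
Proof.
move=> P0; elim: T => [|a [|b T] IH] sT rT; try by exists [::].
have [||Z [sZ uZ gapZ sepZ]] := IH; first exact: path_sorted sT.
  by case/andP: rT.
move: sT rT => /= /andP[ab sbT] /and3P[ra rb _].
have [c /andP[ac cb] oc] := rolle_odd P0 ab ra rb.
have minb t : t \in b :: T -> b <= t.
  rewrite inE => /predU1P[->//|]; move: sbT; rewrite lt_path_sortedE.
  by case/andP=> /allP h _ /h /ltW.
have Zb z : z \in Z -> b < z.
  by move=> /gapZ[_ [a' [b' [/minb h _ /andP[? _] _]]]]; apply: le_lt_trans h _.
exists (c :: Z); split.
- by rewrite /= sZ.
- rewrite /= uZ andbT; apply/negP => /Zb; lra.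
- move=> z; rewrite inE => /predU1P[->|zZ].
    split=> //; exists a, b; rewrite ac cb; split; rewrite ?mem_head //.
      by rewrite !inE eqxx orbT.
    move=> t; rewrite inE => /predU1P[->|/minb ?]; first by rewrite ltxx.
    by apply/negP; lra.
  have [oz [a' [b' [a'T b'T azb gap]]]] := gapZ z zZ; split=> //.
  exists a', b'; split=> //; try by rewrite inE ?a'T ?b'T orbT.
  move=> t; rewrite inE => /predU1P[->|/gap//].
  by have := minb a' a'T; apply: contraL => /andP[? ?]; rewrite -ltNge; lra.
- move=> y z; rewrite !inE => /predU1P[->|yZ] /predU1P[->|zZ]; rewrite ?ltxx //.
  + by move=> _; exists b; rewrite ?inE ?eqxx ?orbT // cb Zb.
  + by have := Zb y yZ; lra.
  + by move=> /(sepZ _ _ yZ zZ)[t tT ?]; exists t; rewrite // inE tT orbT.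
Qed.

(** [mup] is a maximum over exponents bounded by the size, hence 0 on the zero polynomial; so a
    multiplicity equal to 1 already excludes that polynomial. *)
Lemma mup0 x : mup x (0 : {poly R}) = 0%N.
Proof.
by apply/eqP; rewrite -leqn0 -[X in (_ <= X)%N](size_poly0 R) -ltnS; apply: ltn_ord.
Qed.

Lemma mup1_factor P x : mup x P = 1%N ->
  exists2 Q, P = Q * ('X - x%:P) & ~~ root Q x.
Proof.
move=> mx; have P0 : P != 0.
  by apply: contra_eq_neq mx => ->; rewrite mup0.
have [m [Q]] := multiplicity_XsubC P x; rewrite P0 /= => Qx E.
by exists Q => //; move: E mx => ->; rewrite mupMr // mup_XsubCX eqxx => ->.
Qed.

(* [P^`()] has opposite signs next to [a] and next to [b], so it cannot have
   exactly two sign changes in between. *)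
Lemma third_critical_point P a b y w : root P a -> root P b ->
    a < y -> y < w -> w < b -> (forall t, a < t < b -> ~~ root P t) ->
    mup y P^`() = 1%N -> mup w P^`() = 1%N ->
  exists r, [/\ a < r < b, root P^`() r, r != y & r != w].
Proof.
move=> /eqP ra /eqP rb ay yw wb noroot my mw.
have Pyw : 0 < P.[y] * P.[w].
  rewrite ltNge; apply/negP => /(polyrcf.poly_ivt (ltW yw))[t tyw rt].
  have /andP[? ?] : y <= t <= w by rewrite !(itvP tyw).
  by move: rt; apply/negP/noroot/andP; split; lra.
have [Q defQ Qy] := mup1_factor my.
have yw0 : w != y by rewrite gt_eqF.
have mQw : mup w Q = 1%N.
  by rewrite -mw defQ mupMl // root_XsubC.
have [H defH Hw] := mup1_factor mQw.
have [c cay c1E] := poly_mvt P ay.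
have [d dwb d1E] := poly_mvt P wb.
have /andP[? ?] : a < c < y by rewrite !(itvP cay).
have /andP[? ?] : w < d < b by rewrite !(itvP dwb).
(* [P] keeps one sign on [y, w], so its mean slopes at [c] and [d] are opposite; outside [y, w] the
   product (X - y)(X - w) is positive, so [H] inherits these signs. *)
have neg : H.[c] * H.[d] < 0.
  have : (P^`().[c] * P^`().[d]) * ((y - a) * (b - w)) < 0.
    by rewrite mulrACA -c1E -d1E ra rb subr0 sub0r mulrN oppr_lt0.
  rewrite pmulr_llt0 ?mulr_gt0 ?subr_gt0 // defQ defH !hornerM !hornerXsubC.
  have pos : 0 < ((c - w) * (c - y)) * ((d - w) * (d - y)) by apply: mulr_gt0; nra.
  have -> : H.[c] * (c - w) * (c - y) * (H.[d] * (d - w) * (d - y)) =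
      H.[c] * H.[d] * (((c - w) * (c - y)) * ((d - w) * (d - y))) by ring.
  by rewrite pmulr_llt0.
have cd : c < d by lra.
have [r /andP[? ?] /odd_mup_root rH] := odd_root_between cd neg.
exists r; split; first by apply/andP; split; lra.
- by rewrite defQ defH !rootM rH.
- apply: contraNneq Qy => <-; by rewrite defH rootM rH.
- by apply: contraNneq Hw => <-.
Qed.

(** Dividing [P * Q] by (X - x)^2 leaves [P1 * Q1], nonnegative to the left of [x], whose value at
    [x] is the product of the derivatives; by continuity that value is not negative. *)
Lemma simple_zeros_deriv_sign P Q a x : a < x -> mup x P = 1%N -> mup x Q = 1%N ->
  (forall t, a < t < x -> 0 <= P.[t] * Q.[t]) -> 0 < P^`().[x] * Q^`().[x].
Proof.
move=> ax /mup1_factor[P1 -> P1x] /mup1_factor[Q1 -> Q1x] PQ.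
rewrite !derivM !derivXsubC !hornerE subrr !mulr0 !add0r.
rewrite lt_neqAle eq_sym mulf_neq0 //= leNgt; apply/negP => neg.
(* If [m < 0], subtracting [m / 2] makes the weak inequality on the left strict while the value at
   [x] stays negative: the intermediate value theorem then contradicts positivity. *)
set m := P1.[x] * Q1.[x] in neg; pose H := P1 * Q1 - (m / 2)%:P.
have Hpos t : a < t < x -> 0 < H.[t].
  move=> atx; have := PQ t atx; rewrite !hornerM !hornerXsubC mulrACA.
  have pos : 0 < (t - x) * (t - x) by case/andP: atx => *; nra.
  by rewrite pmulr_lge0 // /H hornerD hornerN hornerC hornerM; lra.
have Hx : H.[x] < 0 by rewrite /H hornerD hornerN hornerC hornerM -/m; lra.
pose t := (a + x) / 2.
have atx : a < t < x by rewrite /t; apply/andP; split; lra.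
have tx : t < x by case/andP: atx.
have [r rtx] : {r | r \in `]t, x[ & root H r}.
  by apply: poly_ivtoo; [exact: ltW | rewrite pmulr_rlt0 // Hpos].
have /andP[? ?] : t < r < x by rewrite !(itvP rtx).
move=> /eqP Hr; suff : 0 < H.[r] by rewrite Hr ltxx.
by apply: Hpos; case/andP: atx => *; apply/andP; split; lra.
Qed.

(** The prescriptions are N linear conditions on N + 1 coefficients; [A] is their matrix, and a
    nonzero row of its left kernel lists the coefficients of [q]. *)
Lemma exists_vanishing s W : exists q,
  [/\ q != 0, (size q <= (size s + size W).+1)%N, all (root q) s & all (root q^`()) W].
Proof.
pose N := (size s + size W)%N.
pose ev (j : nat) P := if (j < size s)%N then P.[s`_j] else P^`().[W`_(j - size s)].
have evD j P Q : ev j (P + Q) = ev j P + ev j Q.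
  by rewrite /ev; case: ifP; rewrite ?derivD hornerD.
have evZ j c P : ev j (c *: P) = c * ev j P.
  by rewrite /ev; case: ifP; rewrite ?derivZ hornerZ.
have ev0 j : ev j 0 = 0 by rewrite /ev; case: ifP; rewrite ?deriv0 horner0.
pose A : 'M[R]_(N.+1, N) := \matrix_(i, j) ev j 'X^i.
have /rowV0Pn[v /sub_kermxP vA v0] : kermx A != 0.
  by rewrite kermx_eq0 -row_leq_rank -ltnNge (leq_ltn_trans (rank_leq_col A)).
pose q : {poly R} := \sum_(i < N.+1) v 0 i *: 'X^i.
have evq (j : 'I_N) : ev j q = 0.
  have -> : ev j q = (v *m A) 0 j; last by rewrite vA mxE.
  rewrite mxE /q (big_morph (ev j) (evD j) (ev0 j)).
  by apply: eq_bigr => i _; rewrite evZ mxE.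
exists q; split.
- apply: contraNneq v0 => q0; apply/eqP/rowP => i; rewrite mxE.
  have := congr1 (fun P : {poly R} => P`_i) q0; rewrite coef0 /q coef_sum.
  rewrite (bigD1 i) //= coefZ coefXn eqxx mulr1 big1 ?addr0 // => j ji.
  by rewrite coefZ coefXn eq_sym (inj_eq val_inj) (negbTE ji) mulr0.
- apply: (leq_trans (size_sum _ _ _)); apply/bigmax_leqP => i _.
  by apply: (leq_trans (size_scale_leq _ _)); rewrite size_polyXn.
- apply/(all_nthP 0) => i si; have iN : (i < N)%N by rewrite ltn_addr.
  by have := evq (Ordinal iN); rewrite /ev /= si => /eqP.
- apply/(all_nthP 0) => i si; have iN : (size s + i < N)%N by rewrite ltn_add2l.
  by have := evq (Ordinal iN); rewrite /ev /= ltnNge leq_addr addKn => /eqP.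
Qed.

Lemma factor_uniq_roots P Z : size P = (size Z).+1 -> all (root P) Z -> uniq Z ->
  P = lead_coef P *: \prod_(z <- Z) ('X - z%:P).
Proof. by move=> sP rZ uZ; apply: all_roots_prod_XsubC; rewrite ?uniq_rootsE. Qed.

(* [q] vanishes in [I] exactly at [s]; its critical points are the prescribed list
   [W] and the list [Z] forced by Rolle's theorem. *)
Definition test_poly_spec (I : R -> Prop) s W q Z k := [/\
  [/\ k != 0, (size q <= (size s + size W).+1)%N &
      q^`() = k *: \prod_(z <- Z ++ W) ('X - z%:P)],
  uniq (Z ++ W),
  {in Z, forall z, exists a b, [/\ a \in s, b \in s & a < z < b]},
  {in s, forall x, mup x q = 1%N}
& forall x, I x -> root q x -> x \in s].

Lemma test_poly (I : R -> Prop) s W :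
    (forall a b c, I a -> I b -> a < c < b -> I c) ->
    s != [::] -> sorted <%R s -> {in s, forall x, I x} ->
    uniq W -> {in W, forall w, ~ I w} ->
  exists q Z k, test_poly_spec I s W q Z k.
Proof.
move=> Iconv s0 ss sI uW WI; have [q [q0 szq rs rW]] := exists_vanishing s W.
have us : uniq s := sorted_uniq lt_trans ltxx ss.
have dq0 : q^`() != 0.
  rewrite -size_poly_eq0 size_deriv -subn1 subn_eq0 -ltnNge.
  case: s s0 rs {ss sI us szq} => // x s _ /andP[rx _].
  exact: root_size_gt1 rx.
have sdq : size q^`() = (size q).-1 by rewrite size_deriv.
have rolleW T : sorted <%R T -> all (root q) T -> {in T, forall x, I x} ->
    exists Z, [/\ size Z = (size T).-1, uniq (Z ++ W), all (root q^`()) (Z ++ W),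
      {in Z, forall z, exists a b, [/\ a \in T, b \in T & a < z < b]} &
        {in T, forall t, t \notin Z}].
  move=> sT rT TI; have [Z [sZ uZ gapZ _]] := rolle_seq q0 sT rT.
  exists Z; split=> //.
  - rewrite cat_uniq uZ uW andbT; apply/hasPn => w wW /=; apply/negP => wZ.
    have [_ [a [b [aT bT awb _]]]] := gapZ w wZ.
    by apply: (WI w wW); apply: Iconv awb; exact: TI.
  - rewrite all_cat rW andbT; apply/allP => z /gapZ[oz _]; exact: odd_mup_root.
  - by move=> z /gapZ[_ [a [b [aT bT azb _]]]]; exists a, b.
  - move=> t tT; apply/negP => /gapZ[_ [a [b [_ _ atb]]]] /(_ t tT).
    by rewrite atb.
have [Z [sZ uZW rZW inZ disZ]] := rolleW s ss rs sI.
have s_gt0 : (0 < size s)%N by rewrite lt0n size_eq0.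
have szdq : size q^`() = (size (Z ++ W)).+1.
  apply/eqP; rewrite eqn_leq (max_poly_roots dq0 rZW uZW) andbT size_cat sZ.
  by rewrite sdq -ltnS prednK ?size_poly_gt0 // -addSn prednK.
exists q, Z, (lead_coef q^`()); split=> //.
- by split; rewrite ?lead_coef_eq0 //; exact: factor_uniq_roots.
- move=> x xs; rewrite mup_deriv ?(allP rs) // mupNroot //.
  rewrite (factor_uniq_roots szdq rZW uZW) rootZ ?lead_coef_eq0 // root_prod_XsubC.
  by rewrite mem_cat negb_or disZ //=; apply/negP => /WI; apply; exact: sI.
- move=> x Ix rx; apply/negPn/negP => xs.
  have [||y|T [sT uT rT _ _]] := rolleW (sort <=%R (x :: s)).
  + by rewrite sort_lt_sorted /= xs us.
  + by rewrite all_sort /= rx.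
  + by rewrite mem_sort inE => /predU1P[->|/sI].
  have := max_poly_roots dq0 rT uT.
  by rewrite szdq !size_cat sT sZ size_sort /= ltnS -{1}(prednK s_gt0) addSn ltnn.
Qed.

End RealPoly.

(** * Parity of multiplicities and signs of test polynomials *)

Section PolySign.
Variable R : rcfType.
Implicit Types (P Q q : {poly R}) (a b c u v x y z : R) (T Z W s : seq R).
Lemma mupZ (F : fieldType) (k : F) (P : {poly F}) (x : F) :
  k != 0 -> mup x (k *: P) = mup x P.
Proof. by move=> k0; rewrite -mul_polyC mupMr // rootC. Qed.

Lemma horner_prod_XsubC Z x : (\prod_(z <- Z) ('X - z%:P)).[x] = \prod_(z <- Z) (x - z).
Proof. by rewrite horner_prod; apply: eq_bigr => z _; rewrite hornerXsubC. Qed.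

Lemma odd_zeros_seq (I : R -> Prop) P : P != 0 ->
  exists s, sorted <%R s /\ forall x, x \in s <-> I x /\ odd (mup x P).
Proof.
move=> P0; exists (sort <=%R (undup [seq x <- rootsR P | `[< I x >] && odd (mup x P)])).
rewrite sort_lt_sorted undup_uniq; split=> // x.
rewrite mem_sort mem_undup mem_filter -(roots_on_rootsR P0) inE /=.
split=> [/andP[/andP[/asboolP]]//|[Ix ox]].
by rewrite ox (odd_mup_root ox) !andbT; apply/asboolP.
Qed.

(** Dividing by the known roots leaves a linear cofactor. Its root [w] cannot be in [Z], since it
    would have multiplicity 2 there, against parity. *)
Lemma factor_extra_root P Z : size P = (size Z).+2 -> uniq Z ->
    {in Z, forall z, odd (mup z P)} ->
  exists2 w, w \notin Z & P = lead_coef P *: \prod_(z <- w :: Z) ('X - z%:P).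
Proof.
move=> sP uZ oZ.
have P0 : P != 0 by rewrite -size_poly_eq0 sP.
have rZ : all (root P) Z by apply/allP => z /oZ/odd_mup_root.
have [|q defP] := @uniq_roots_prod_XsubC _ P Z rZ; first by rewrite uniq_rootsE.
have q0 : q != 0 by apply: contraNneq P0 => q0; rewrite defP q0 mul0r.
have sq : size q = 2%N.
  have := sP; rewrite {1}defP size_Mmonic ?monic_prod_XsubC //.
  by rewrite (size_prod_XsubC Z id) addnS /= -addn2 addnC => /addnI.
have [w rw] := poly2_root sq; have wZ : w \notin Z.
  apply/negP => wZ; have := oZ w wZ.
  rewrite defP mupM ?(monic_neq0 (monic_prod_XsubC _ _ _)) // mu_prod_XsubC
      count_uniq_mem // wZ addn1 /=.
  have [r defq] := factor_theorem _ _ rw; move: sq q0; rewrite defq.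
  have [->|r0] := eqVneq r 0; first by rewrite mul0r eqxx.
  rewrite size_Mmonic ?monicXsubC // size_XsubC addn2 /= => -[/eqP/size_poly1P[c c0 ->]] _.
  by rewrite mul_polyC mupZ // (@mup_XsubCX _ 1) eqxx.
exists w => //; apply: factor_uniq_roots; rewrite ?sP //= ?wZ // rZ andbT.
by rewrite defP rootM rw.
Qed.

(** Here [D] is an interval and [I] its interior: opposite signs at two points of [D] give an odd
    zero strictly between them, hence in [I]. Parity inside thus controls the sign up to the end
    points. *)
Lemma const_sign (D I : R -> Prop) P :
    (forall u v c, D u -> D v -> u < c < v -> I c) ->
    (forall c, I c -> ~~ odd (mup c P)) ->
  (forall x, D x -> 0 <= P.[x]) \/ (forall x, D x -> P.[x] <= 0).
Proof.
move=> DI ev; have [nonneg|] := pselect (forall x, D x -> 0 <= P.[x]); first by left.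
move=> /existsNP[x /not_implyP[Dx /negP]]; rewrite -ltNge => Px; right=> y Dy.
rewrite leNgt; apply/negP => Py.
have [xy|yx|xy] := ltgtP x y; last by move: Px; rewrite xy; lra.
  have [|c xcy oc] := odd_root_between (P := P) xy; first by nra.
  by move: oc; apply/negP/ev/(DI x y).
have [|c xcy oc] := odd_root_between (P := P) yx; first by nra.
by move: oc; apply/negP/ev/(DI y x).
Qed.

(** A Rolle zero that does not separate [x] from [t] contributes a positive factor, and the constant
    [k] enters squared; only the prescribed points [W] can affect the sign. *)
Lemma test_poly_deriv_sign (I : R -> Prop) s W q Z k x t :
    test_poly_spec I s W q Z k ->
    (forall a b z, a \in s -> b \in s -> a < z < b -> 0 < (x - z) * (t - z)) ->
  exists2 m, 0 < m & q^`().[x] * q^`().[t] =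
    m * \prod_(w <- W) ((x - w) * (t - w)).
Proof.
move=> [[k0 _ ->] _ inZ _ _] sep.
exists (k ^+ 2 * \prod_(z <- Z) ((x - z) * (t - z))).
  rewrite mulr_gt0 ?exprn_even_gt0 // big_seq prodr_gt0 // => z /inZ[a [b [sa sb azb]]].
  exact: sep azb.
rewrite !hornerZ !horner_prod_XsubC !big_cat !big_split /=; ring.
Qed.

Lemma test_poly_specN (I : R -> Prop) s W q Z k :
  test_poly_spec I s W q Z k -> test_poly_spec I s W (- q) Z (- k).
Proof.
move=> [[k0 sq dq] u inZ ms Is]; split=> //; first split.
- by rewrite oppr_eq0.
- by rewrite size_polyN.
- by rewrite derivN dq scaleNr.
- by move=> x xs; rewrite -scaleN1r mupZ ?oppr_eq0 ?oner_eq0 // ms.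
- by move=> x Ix; rewrite rootN; apply: Is.
Qed.

Lemma test_poly_neq0 (I : R -> Prop) s W q Z k :
  test_poly_spec I s W q Z k -> q != 0.
Proof.
move=> [[k0 _ dq] _ _ _ _]; apply: contraNneq k0 => q0; move: dq.
rewrite q0 deriv0 => /esym/eqP; rewrite scaler_eq0.
by rewrite (negbTE (monic_neq0 (monic_prod_XsubC _ _ _))) orbF.
Qed.

Lemma mup_test_poly (I : R -> Prop) s W q Z k x :
  test_poly_spec I s W q Z k -> I x -> mup x q = (x \in s).
Proof.
move=> [_ _ _ ms Is] Ix; have [/ms//|/negP xs] := boolP (x \in s).
by rewrite mupNroot //; apply/negP => /(Is x Ix).
Qed.

Lemma mup_test_poly_deriv (I : R -> Prop) s W q Z k x :
  test_poly_spec I s W q Z k -> mup x q^`() = (x \in Z ++ W).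
Proof.
by move=> [[k0 _ ->] u _ _ _]; rewrite mupZ // mu_prod_XsubC count_uniq_mem.
Qed.

End PolySign.

(** * Consequences of first-order optimality: lower bound and critical points *)

(* [I0] and [I1] stand for the interiors of [D0] and [D1], and [K] for the interior
   of the hull minus [I1]; [extremal] is first-order optimality. *)
Section Extremal.
Variable R : rcfType.
Variables (D0 D1 I0 I1 K : R -> Prop) (n : nat) (L : {poly R}).
Implicit Types (P Q q : {poly R}) (a b c u v w x y z t : R) (T Z W : seq R).

Hypothesis I0D0 : forall x, I0 x -> D0 x.
Hypothesis I1D1 : forall x, I1 x -> D1 x.
Hypothesis D0I0 : forall u v c, D0 u -> D0 v -> u < c < v -> I0 c.
Hypothesis D1I1 : forall u v c, D1 u -> D1 v -> u < c < v -> I1 c.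
Hypothesis I0_left : forall x, I0 x -> exists2 a, a < x & I0 a.
Hypothesis side : (forall x t, I0 x -> D1 t -> x < t) \/
  (forall x t, I0 x -> D1 t -> t < x).
Hypothesis separator : (exists t, D1 t) -> exists c, [/\ ~ I0 c, ~ I1 c &
  forall x t, I0 x -> D1 t -> (x - c) * (t - c) <= 0].
Hypothesis K_I1 : forall a, K a -> ~ I1 a.
Hypothesis K_conv : forall a b c, K a -> K b -> a < c < b -> ~ I1 c.
Hypothesis I0K : forall x, I0 x -> K x.

Hypothesis n_gt0 : (0 < n)%N.
Hypothesis L_monic : L \is monic.
Hypothesis L_size : size L = n.+1.
Hypothesis extremal : forall q, q != 0 -> (size q <= n)%N ->
  (forall x, D0 x -> 0 <= (q * L).[x]) ->
  (forall x, D1 x -> 0 <= (q^`() * L^`()).[x]) -> False.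

Variables s Y : seq R.
Hypothesis s_sorted : sorted <%R s.
Hypothesis mem_s : forall x, x \in s <-> I0 x /\ odd (mup x L).
Hypothesis Y_uniq : uniq Y.
Hypothesis mem_Y : forall x, x \in Y <-> I1 x /\ odd (mup x L^`()).

Let I0_conv a b c : I0 a -> I0 b -> a < c < b -> I0 c.
Proof. by move=> /I0D0 Da /I0D0 Db; apply: D0I0. Qed.

Let disj x : I0 x -> D1 x -> False.
Proof. by move=> I0x D1x; case: side => /(_ x x I0x D1x); rewrite ltxx. Qed.

Let L0 : L != 0. Proof. by rewrite monic_neq0. Qed.

Let size_dL : size L^`() = n. Proof. by rewrite size_deriv L_size. Qed.

Let dL0 : L^`() != 0. Proof. by rewrite -size_poly_eq0 size_dL -lt0n. Qed.

Let s_uniq : uniq s := sorted_uniq lt_trans ltxx s_sorted.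

Let s_I0 x : x \in s -> I0 x. Proof. by case/mem_s. Qed.

Let s_root : all (root L) s.
Proof. by apply/allP => x /mem_s[_ /odd_mup_root]. Qed.

Let Y_I1 x : x \in Y -> I1 x. Proof. by case/mem_Y. Qed.

Let Y_root : all (root L^`()) Y.
Proof. by apply/allP => x /mem_Y[_ /odd_mup_root]. Qed.

Let Y_notI0 x : x \in Y -> ~ I0 x.
Proof. by move=> /Y_I1/I1D1 D1x /disj; apply. Qed.

(** Otherwise a constant 1 or -1 would contradict optimality, its derivative making the condition on
    [D1] trivial. *)
Lemma odd_zeros_neq0 : s != [::].
Proof.
apply/eqP => s0.
have [Lpos|Lneg] : (forall x, D0 x -> 0 <= L.[x]) \/ (forall x, D0 x -> L.[x] <= 0).
- apply: const_sign D0I0 _ => c Ic; apply/negP => oc.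
  by have /mem_s : I0 c /\ odd (mup c L) by []; rewrite s0.
- apply: (@extremal 1); rewrite ?oner_eq0 ?size_poly1 //.
  + by move=> x /Lpos; rewrite mul1r.
  + by move=> x _; rewrite derivC mul0r horner0.
- apply: (@extremal (- 1)); rewrite ?oppr_eq0 ?oner_eq0 ?size_polyN ?size_poly1 //.
  + by move=> x /Lneg; rewrite mulN1r hornerN oppr_ge0.
  + by move=> x _; rewrite derivN derivC oppr0 mul0r horner0.
Qed.

(** In [I0] the zeros of [q] are simple and are the odd zeros of [L], so [q * L] has only even zeros
    there; the sign of [q] is then adjusted. *)
Lemma oriented_test_poly W : uniq W -> {in W, forall w, ~ I0 w} ->
  exists q Z k, test_poly_spec I0 s W q Z k /\ forall x, D0 x -> 0 <= (q * L).[x].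
Proof.
move=> uW WI.
have [q [Z [k spec]]] := test_poly I0_conv odd_zeros_neq0 s_sorted s_I0 uW WI.
have q0 := test_poly_neq0 spec.
have [pos|neg] : (forall x, D0 x -> 0 <= (q * L).[x]) \/
    (forall x, D0 x -> (q * L).[x] <= 0).
- apply: const_sign D0I0 _ => c Ic; rewrite mupM // (mup_test_poly spec Ic) oddD oddb.
  have := mem_s c; have [cs [/(_ isT)[_ ->]]|cs [_ /(_ (conj Ic _))h]] //
      := boolP (c \in s).
  by apply/negP => /h.
- by exists q, Z, k.
- exists (- q), Z, (- k); split; first exact: test_poly_specN.
  by move=> x /neg; rewrite mulNr hornerN oppr_ge0.
Qed.

Lemma test_poly_deriv_const_sign W q Z k : test_poly_spec I0 s W q Z k ->
    (forall x, I1 x -> (x \in W) = (x \in Y)) ->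
  (forall x, D1 x -> 0 <= (q^`() * L^`()).[x]) \/
  (forall x, D1 x -> (q^`() * L^`()).[x] <= 0).
Proof.
move=> spec WY; have [[k0 _ dq] _ inZ _ _] := spec.
have dq0 : q^`() != 0.
  by rewrite dq scaler_eq0 negb_or k0 (monic_neq0 (monic_prod_XsubC _ _ _)).
apply: const_sign D1I1 _ => c Ic; rewrite mupM // (mup_test_poly_deriv c spec) oddD oddb.
have cZ : c \notin Z.
  apply/negP => /inZ[a [b [/s_I0 Ia /s_I0 Ib acb]]].
  exact: disj (I0_conv Ia Ib acb) (I1D1 Ic).
rewrite mem_cat (negbTE cZ) WY //=.
have := mem_Y c; have [cs [/(_ isT)[_ ->]]|cs [_ /(_ (conj Ic _))h]] // := boolP (c \in Y).
by apply/negP => /h.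
Qed.

Lemma deriv_sign_at_zero P Q x : I0 x -> mup x P = 1%N -> mup x Q = 1%N ->
  (forall t, D0 t -> 0 <= (P * Q).[t]) -> 0 < P^`().[x] * Q^`().[x].
Proof.
move=> Ix mP mQ PQ; have [a ax Ia] := I0_left Ix.
apply: simple_zeros_deriv_sign ax mP mQ _ => t atx; rewrite -hornerM.
by apply/PQ/I0D0/(I0_conv Ia Ix).
Qed.

(* [x] is the zero closest to [D1], so that no critical point [z] of Rolle type
   separates it from [t]. *)
Lemma facing_zero : exists2 x, x \in s & forall t, D1 t ->
  forall a b z, a \in s -> b \in s -> a < z < b -> 0 < (x - z) * (t - z).
Proof.
have s_gt0 : (0 < size s)%N by rewrite lt0n size_eq0 odd_zeros_neq0.
have s_nth i : (i < size s)%N -> I0 s`_i by move=> si; apply/s_I0/mem_nth.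
have mono i j : (i < size s)%N -> (j < size s)%N -> (i <= j)%N -> s`_i <= s`_j.
  by move=> si sj ij; rewrite (lt_sorted_leq_nth 0 s_sorted).
case: side => sd.
- have lt1 : ((size s).-1 < size s)%N by rewrite prednK.
  exists s`_(size s).-1; first exact: mem_nth.
  move=> t D1t a b z _ /(nthP 0)[j sj <-] /andP[_ zb].
  have := sd _ _ (s_nth _ lt1) D1t.
  have := mono _ _ sj lt1; rewrite -ltnS prednK // => /(_ sj) ? ?.
  by rewrite mulr_gt0 // subr_gt0; lra.
- exists s`_0; first exact: mem_nth.
  move=> t D1t a b z /(nthP 0)[j sj <-] _ /andP[az _].
  have := sd _ _ (s_nth _ s_gt0) D1t; have := mono _ _ s_gt0 sj isT => ? ?.
  by rewrite -mulrNN mulr_gt0 // oppr_gt0 subr_lt0; lra.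
Qed.

(** Dictionary: [e], [f] are the derivatives of [q1], [q2] at the facing zero [x]; [a], [b], [l]
    those of [q1], [q2], [L] at [t] in [D1]; [A] is the product over [Y], and [g] the factor of the
    extra point [c], which separates [x] from [t]. *)
Lemma sign_transfer (a b e f l A g m1 m2 : R) : 0 < m1 -> 0 < m2 ->
  e * a = m1 * A -> f * b = m2 * (g * A) -> 0 < e * f -> g <= 0 -> a * l <= 0 -> 0 <= b * l.
Proof.
move=> m1_gt0 m2_gt0 E1 E2 ef g0 al.
have f0 : f != 0 by apply: contraTneq ef => ->; rewrite mulr0 ltxx.
have [a0|a0] := eqVneq a 0.
  move: E1; rewrite a0 mulr0 => /esym/eqP; rewrite mulf_eq0 gt_eqF //= => /eqP A0.
  by move/eqP: E2; rewrite A0 !mulr0 mulf_eq0 (negbTE f0) => /eqP ->; rewrite mul0r.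
have ab : a * b <= 0.
  rewrite -(pmulr_rle0 _ ef) mulrACA E1 E2.
  have -> : m1 * A * (m2 * (g * A)) = m1 * m2 * (A ^+ 2) * g by ring.
  by apply: mulr_ge0_le0 => //; apply: mulr_ge0 (sqr_ge0 A); apply: ltW; apply: mulr_gt0.
have a2 : 0 < a ^+ 2 by rewrite exprn_even_gt0.
rewrite -(pmulr_lge0 _ a2); have -> : b * l * a ^+ 2 = (a * b) * (a * l) by ring.
exact: mulr_le0.
Qed.

(* If the sign of [q1'] on [D1] is the wrong one, a further critical point [c]
   between [D0] and [D1] reverses it at the cost of one degree. *)
Lemma odd_zeros_lower_bound : (n.-1 <= size s + size Y)%N.
Proof.
rewrite leqNgt; apply/negP => few.
have few1 : ((size s + size Y).+2 <= n)%N by move: few; case: (n) => // m; rewrite !ltnS.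
have [q1 [Z1 [k1 [spec1 q1L]]]] := oriented_test_poly Y_uniq Y_notI0.
have [[_ sq1 _] _ _ _ _] := spec1.
have sq1n : (size q1 <= n)%N by apply: leq_trans sq1 _; apply: ltnW.
have q10 := test_poly_neq0 spec1.
have [D1ne|D1e] := pselect (exists t, D1 t); last first.
  by apply: (extremal q10) => // x D1x; case: D1e; exists x.
have [c [I0c I1c sepc]] := separator D1ne.
have Yc : c \notin Y by apply/negP => /Y_I1.
have [q2 [Z2 [k2 [spec2 q2L]]]] : exists q Z k,
    test_poly_spec I0 s (c :: Y) q Z k /\ forall x, D0 x -> 0 <= (q * L).[x].
  apply: oriented_test_poly; first by rewrite /= Yc.
  by move=> w; rewrite inE => /predU1P[->//|/Y_notI0].
have [[_ sq2 _] _ _ _ _] := spec2; rewrite /= addnS in sq2.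
have sq2n : (size q2 <= n)%N by apply: leq_trans few1.
have q20 := test_poly_neq0 spec2.
have [pos1|neg1] := test_poly_deriv_const_sign spec1 (fun _ _ => erefl).
  exact: extremal pos1.
apply: (extremal q20) => // t D1t.
have [x xs sepx] := facing_zero; have Ix := s_I0 xs.
have [m1 m1_gt0 E1] := test_poly_deriv_sign spec1 (sepx t D1t).
have [m2 m2_gt0 E2] := test_poly_deriv_sign spec2 (sepx t D1t).
have m1x : mup x q1 = 1%N by rewrite (mup_test_poly spec1 Ix) xs.
have m2x : mup x q2 = 1%N by rewrite (mup_test_poly spec2 Ix) xs.
(* [q1] and [q2] both agree in sign with [L], which says nothing where [L] vanishes. But [q1 * q2]
   has only even zeros in [I0], so one point [d] outside all zeros decides its sign. *)
have q12 y : D0 y -> 0 <= (q1 * q2).[y].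
  have [//|neg] : (forall x, D0 x -> 0 <= (q1 * q2).[x]) \/
      (forall x, D0 x -> (q1 * q2).[x] <= 0).
  - by apply: const_sign D0I0 _ => d Id; rewrite mupM // (mup_test_poly spec1 Id)
      (mup_test_poly spec2 Id) addnn odd_double.
  - exact.
  have [a ax Ia] := I0_left Ix.
  have [|d adx] := @nonroot_between _ (q1 * L * (q2 * L)) a x _ ax.
    by rewrite !mulf_neq0.
  have D0d := I0D0 (I0_conv Ia Ix adx).
  have : 0 <= (q1 * L * (q2 * L)).[d] by rewrite hornerM mulr_ge0 ?q1L ?q2L.
  rewrite mulrACA -expr2 hornerM horner_exp le_eqVlt eq_sym => /predU1P[->|];
      first by rewrite eqxx.
  by rewrite ltNge mulr_le0_ge0 ?sqr_ge0 ?neg.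
rewrite big_cons in E2; rewrite hornerM.
apply: sign_transfer m1_gt0 m2_gt0 E1 E2 _ (sepc x t Ix D1t) _.
  exact: deriv_sign_at_zero q12.
by rewrite -hornerM neg1.
Qed.

(* [Z] comes from Rolle's theorem on [s]; [E] holds the exceptional critical
   point, if any. *)
Lemma crit_structure : exists E Z, [/\ (size E <= 1)%N,
    L^`() = lead_coef L^`() *: \prod_(z <- E ++ Z ++ Y) ('X - z%:P),
    uniq (E ++ Z ++ Y),
    {in Z, forall z, exists a b, [/\ a \in s, b \in s,
       a < z < b & {in s, forall t, ~~ (a < t < b)}]}
  & {in Z &, forall y z, y < z -> exists2 t, t \in s & y < t < z}]
  /\ (size s + size Y + size E = n)%N.
Proof.
have [Z [sZ uZ gapZ sepZ]] := rolle_seq L0 s_sorted s_root.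
have s_gt0 : (0 < size s)%N by rewrite lt0n size_eq0 odd_zeros_neq0.
have gap' z : z \in Z -> exists a b, [/\ a \in s, b \in s,
       a < z < b & {in s, forall t, ~~ (a < t < b)}] by case/gapZ.
have uZY : uniq (Z ++ Y).
  rewrite cat_uniq uZ Y_uniq andbT; apply/hasPn => y yY /=; apply/negP.
  move=> /gap'[a [b [/s_I0 Ia /s_I0 Ib ayb _]]].
  exact: Y_notI0 yY (I0_conv Ia Ib ayb).
have odd_ZY : {in Z ++ Y, forall z, odd (mup z L^`())}.
  by move=> z; rewrite mem_cat => /orP[/gapZ[]|/mem_Y[]].
have rZY : all (root L^`()) (Z ++ Y) by apply/allP => z /odd_ZY/odd_mup_root.
have := max_poly_roots dL0 rZY uZY; rewrite size_dL size_cat sZ => lt_n.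
have := odd_zeros_lower_bound => ge_n.
(* The degree n - 1 leaves room for at most one critical point beyond [Z ++ Y]. *)
have [N_n|N_n] : (size s + size Y = n \/ size s + size Y = n.-1)%N.
  by move: (size s) (size Y) lt_n ge_n s_gt0 n_gt0 => i j; clear; lia.
- exists [::], Z; split; last by rewrite addn0.
  split=> //; apply: factor_uniq_roots => //.
  by rewrite /= size_dL size_cat sZ -addSn prednK.
- have [|w wZY dL] := factor_extra_root _ uZY odd_ZY.
    by rewrite size_dL size_cat sZ -[LHS]prednK // -N_n; congr _.+1; rewrite -addSn prednK.
  exists [:: w], Z; split; last by rewrite addn1 N_n prednK.
  by split=> //=; rewrite wZY.
Qed.

(** * Simplicity, number and location of zeros and critical points *)

Lemma crit_simple z : root L^`() z -> mup z L^`() = 1%N.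
Proof.
have [E [Z [[_ dL uW _ _] _]]] := crit_structure.
have mE x : mup x L^`() = (x \in E ++ Z ++ Y).
  by rewrite dL mupZ ?lead_coef_eq0 // mu_prod_XsubC count_uniq_mem.
by rewrite -mup_gt0 // mE lt0b => ->.
Qed.

(** Splitting over the reals with distinct roots is what later excludes nonreal critical points. *)
Lemma crit_factor : exists2 W, uniq W &
  L^`() = lead_coef L^`() *: \prod_(z <- W) ('X - z%:P).
Proof. by have [E [Z [[_ dL uW _ _] _]]] := crit_structure; exists (E ++ Z ++ Y). Qed.

(** Rolle zeros between points of [K] avoid [I1], hence [Y]. A critical point belonging to [T] is
    new as well: Rolle zeros are not in [T], and [K] misses [I1]. All of them count against the
    degree n - 1. *)
Lemma count_zeros T : uniq T -> T != [::] -> all (root L) T -> {in T, forall t, K t} ->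
  (size T + size Y + has (root L^`()) T <= n)%N.
Proof.
move=> uT T0 rT TK; pose T' := sort <=%R T.
have sT : sorted <%R T' by rewrite sort_lt_sorted.
have [|Z [sZ uZ gapZ _]] := @rolle_seq _ L T' L0 sT; first by rewrite all_sort.
have T_gt0 : (0 < size T)%N by rewrite lt0n size_eq0.
have memT t : (t \in T') = (t \in T) by rewrite mem_sort.
have ZY y : y \in Y -> y \notin Z.
  move=> /Y_I1 I1y; apply/negP => /gapZ[_ [a [b []]]]; rewrite !memT => /TK Ka /TK Kb ayb _.
  exact: K_conv ayb I1y.
have uZY : uniq (Z ++ Y).
  by rewrite cat_uniq uZ Y_uniq andbT; apply/hasPn => y /ZY.
have rZY : all (root L^`()) (Z ++ Y).
  by rewrite all_cat Y_root andbT; apply/allP => z /gapZ[/odd_mup_root].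
have [/hasP[t tT rt]|_] := boolP (has _ T).
- have tZY : t \notin Z ++ Y.
    rewrite mem_cat negb_or; apply/andP; split; apply/negP.
      by move=> /gapZ[_ [a [b [_ _ atb]]]] /(_ t); rewrite memT => /(_ tT); rewrite atb.
    by move=> /Y_I1; apply/K_I1/TK.
  have := @max_poly_roots _ L^`() (t :: Z ++ Y) dL0.
  rewrite /= rt rZY tZY uZY => /(_ isT isT).
  by rewrite size_dL size_cat sZ size_sort -addSn prednK // addn1.
- have := max_poly_roots dL0 rZY uZY.
  by rewrite size_dL size_cat sZ size_sort -addSn prednK // addn0.
Qed.

(** A multiple zero in [s] would be a critical point of even multiplicity, but critical points are
    simple. One outside [s] counts twice in [count_zeros], as a zero and as a critical point,
    against the lower bound. *)
Lemma zeros_simple x : K x -> root L x -> mup x L = 1%N.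
Proof.
move=> Kx rx; rewrite mup_deriv //; congr _.+1.
apply/eqP; rewrite -leqn0 leqNgt mup_gt0 //; apply/negP => rdx.
have [xs|xs] := boolP (x \in s).
  have /mem_s[_] := xs; rewrite mup_deriv //= => ev.
  by rewrite (crit_simple rdx) in ev.
have := @count_zeros (x :: s); rewrite /= xs s_uniq rx s_root rdx /= => /(_ isT isT isT).
have Kxs : {in x :: s, forall t, K t}.
  by move=> t; rewrite inE => /predU1P[->|/s_I0/I0K].
move=> /(_ Kxs); rewrite addn1 addSn => le_n.
by have := odd_zeros_lower_bound; rewrite leqNgt -ltnS prednK // le_n.
Qed.

Lemma mem_zeros x : I0 x -> root L x -> x \in s.
Proof. by move=> Ix rx; apply/mem_s; rewrite zeros_simple //; apply: I0K. Qed.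

Lemma zero_not_crit x : K x -> root L x -> ~~ root L^`() x.
Proof.
move=> Kx rx; have := zeros_simple Kx rx; rewrite mup_deriv // => -[m0].
by rewrite -mup_gt0 // m0.
Qed.

Lemma odd_zeros_upper_bound : (size s + size Y <= n)%N.
Proof.
have sK : {in s, forall t, K t} by move=> t /s_I0/I0K.
have := count_zeros s_uniq odd_zeros_neq0 s_root sK.
by apply: leq_trans; rewrite leq_addr.
Qed.

(** Two zeros added to [s] would exceed the bound of [count_zeros], because [size s + size Y] is
    already at least n - 1. *)
Lemma gap_zero_unique x y : K x -> K y -> ~ I0 x -> ~ I0 y ->
  root L x -> root L y -> x = y.
Proof.
move=> Kx Ky I0x I0y rx ry; apply/eqP/negPn/negP => xy.
have xs : x \notin s by apply/negP => /s_I0.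
have ys : y \notin s by apply/negP => /s_I0.
have := @count_zeros [:: x, y & s]; rewrite /= inE negb_or xs ys xy s_uniq rx ry s_root.
have Kxs : {in [:: x, y & s], forall t, K t}.
  by move=> t; rewrite !inE => /or3P[/eqP->|/eqP->|/s_I0/I0K].
move=> /(_ isT isT isT Kxs) le_n.
have := odd_zeros_lower_bound; rewrite leqNgt -ltnS prednK //.
by rewrite (leq_trans _ le_n) // !addSn; apply: leq_addr.
Qed.

Lemma gap_crit_unique x y : ~ I0 x -> ~ I1 x -> ~ I0 y -> ~ I1 y ->
  root L^`() x -> root L^`() y -> x = y.
Proof.
move=> I0x I1x I0y I1y.
have [E [Z [[E1 dL _ gapZ _] _]]] := crit_structure.
have inE' z : ~ I0 z -> ~ I1 z -> root L^`() z -> z \in E.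
  move=> I0z I1z; rewrite dL rootZ ?lead_coef_eq0 // root_prod_XsubC !mem_cat.
  case/or3P => // [/gapZ[a [b [/s_I0 Ia /s_I0 Ib azb _]]]|/Y_I1//].
  by case: I0z; apply: I0_conv azb.
move=> /(inE' x I0x I1x) xE /(inE' y I0y I1y) yE.
by case: E E1 xE yE {dL inE'} => [|e [|//]] // _; rewrite !inE => /eqP-> /eqP->.
Qed.

(** Only the exceptional critical point needs an argument. If it separated the facing zero [x] from
    no point of [D1], it would not affect the sign carried from [x] to [D1], and the test polynomial
    with [W = Y] would contradict optimality. *)
Lemma crit_location z : root L^`() z ->
  [\/ exists a b, [/\ a \in s, b \in s & a < z < b], I1 z |
      exists x t, [/\ x \in s, D1 t & (x - z) * (t - z) < 0]].
Proof.
have [E [Z [[E1 dL uW gapZ sepZ] sN]]] := crit_structure.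
rewrite dL rootZ ?lead_coef_eq0 // root_prod_XsubC !mem_cat.
case/or3P => [zE|/gapZ[a [b [sa sb azb _]]]|/Y_I1 ?]; [
  |by constructor 1; exists a, b|by constructor 2].
have defE : E = [:: z].
  by case: E E1 zE {dL uW sN} => [|e [|//]] // _; rewrite inE => /eqP->.
constructor 3; apply: contrapT => noxt.
have [q [Z1 [k1 [spec qL]]]] := oriented_test_poly Y_uniq Y_notI0.
have [[_ sq _] _ _ _ _] := spec.
(* The exceptional point accounts for one unit of [sN], exactly the unit needed to bound the size of
   [q]. *)
have sqn : (size q <= n)%N by rewrite -sN defE addn1.
have [x xs sepx] := facing_zero; have Ix := s_I0 xs.
have mq : mup x q = 1%N by rewrite (mup_test_poly spec Ix) xs.
have rx : root L x by apply: (allP s_root).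
have ef := deriv_sign_at_zero Ix mq (zeros_simple (I0K Ix) rx) qL.
apply: (extremal (test_poly_neq0 spec) sqn qL) => t D1t.
have [m m_gt0 Em] := test_poly_deriv_sign spec (sepx t D1t).
rewrite hornerM -(pmulr_rge0 _ ef) mulrACA Em dL !hornerZ !horner_prod_XsubC defE.
rewrite [X in _ <= _ * X]mulrACA -expr2 -big_split /= big_cons big_cat /=.
set A := \prod_(w <- Y) _; set B := \prod_(w <- Z) _; set g := (x - z) * (t - z).
have B_gt0 : 0 < B.
  rewrite /B big_seq prodr_gt0 // => y /gapZ[a [b [sa sb ayb _]]].
  exact: sepx ayb.
have g_ge0 : 0 <= g by rewrite leNgt; apply/negP => g0; apply: noxt; exists x, t.
set l := lead_coef _.
have -> : m * A * (l ^+ 2 * (g * (B * A))) = (m * B * l ^+ 2 * A ^+ 2) * g by ring.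
apply: mulr_ge0 => //; apply: mulr_ge0 (sqr_ge0 A); apply: mulr_ge0 (sqr_ge0 l).
by apply: mulr_ge0; apply: ltW.
Qed.

(** * Interlacing *)

Lemma crit_between_zeros_unique a b y w : I0 a -> I0 b -> root L a -> root L b ->
    (forall t, a < t < b -> ~~ root L t) -> a < y < b -> a < w < b ->
  root L^`() y -> root L^`() w -> y = w.
Proof.
wlog yw : y w / y < w.
  move=> wl Ia Ib ra rb nr ayb awb ry rw_.
  by have [yw|wy|//] := ltgtP y w; [apply: wl|apply/esym/wl].
move=> Ia Ib ra rb nr /andP[ay yb] /andP[aw wb] ry rw_.
have [r [/andP[ar rb'] rr ry' rw']] :=
  third_critical_point ra rb ay yw wb nr (crit_simple ry) (crit_simple rw_).
(* Pigeonhole for the three critical points [y], [w], [r]: at most one is in [E], and at most one in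
   [Z], because two points of [Z] are separated by a zero of [L]. *)
have [E [Z [[E1 dL _ gapZ sepZ] _]]] := crit_structure.
have inEZ z : a < z < b -> root L^`() z -> z \in E \/ z \in Z.
  move=> azb; rewrite dL rootZ ?lead_coef_eq0 // root_prod_XsubC !mem_cat.
  case/or3P=> [||/Y_notI0]; [by left|by right|].
  by case; apply: I0_conv azb.
have oneE u v : u \in E -> v \in E -> u = v.
  by case: E E1 {dL inEZ} => [|e [|//]] // _; rewrite !inE => /eqP-> /eqP->.
have oneZ u v : a < u -> v < b -> u \in Z -> v \in Z -> u < v -> False.
  move=> au vb uZ vZ uv; have [t ts /andP[ut tv]] := sepZ u v uZ vZ uv.
  by have := nr t; rewrite (lt_trans au ut) (lt_trans tv vb) (allP s_root) // => /(_ isT).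
have oneZ' u v : a < u -> v < b -> a < v -> u < b -> u \in Z -> v \in Z -> u = v.
  move=> au vb av ub uZ vZ; have [uv|vu|//] := ltgtP u v.
    by case: (oneZ u v).
  by case: (oneZ v u).
have [|yE|yZ] := inEZ y _ ry; first by rewrite ay.
- have [|wE|wZ] := inEZ w _ rw_; [by rewrite aw|exact: oneE|].
  have [|rE|rZ] := inEZ r _ rr; first by rewrite ar.
    by rewrite (oneE _ _ rE yE) eqxx in ry'.
  by rewrite (oneZ' r w) ?eqxx in rw'.
- have [|wE|wZ] := inEZ w _ rw_; [by rewrite aw| |exact: oneZ'].
  have [|rE|rZ] := inEZ r _ rr; first by rewrite ar.
    by rewrite (oneE _ _ rE wE) eqxx in rw'.
  by rewrite (oneZ' r y) ?eqxx in ry'.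
Qed.

Lemma interlace_zeros x y : I0 x -> I0 y -> x < y -> root L x -> root L y ->
    (forall z, I0 z -> x < z < y -> ~~ root L z) ->
  exists! z, x < z < y /\ root L^`() z.
Proof.
move=> Ix Iy xy rx ry nr; have [c xcy /odd_mup_root rc] := rolle_odd L0 xy rx ry.
exists c; split=> // z [xzy rz].
by apply: (crit_between_zeros_unique Ix Iy) => // t xty; apply: nr => //;
    apply: I0_conv xty.
Qed.

(** At most one of [x], [y] is exceptional; the other is a Rolle zero, bracketed by consecutive
    zeros [a], [b] of [L]. By uniqueness inside the bracket the other point lies beyond it, so [a]
    or [b] falls between [x] and [y]. *)
Lemma interlace_crit x y : I0 x -> I0 y -> x < y -> root L^`() x -> root L^`() y ->
    (forall z, I0 z -> x < z < y -> ~~ root L^`() z) ->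
  exists! z, x < z < y /\ root L z.
Proof.
move=> Ix Iy xy rx ry nr.
have I0xy z : x < z < y -> I0 z by apply: I0_conv.
suff [z xzy rz] : exists2 z, x < z < y & root L z.
  exists z; split=> // t [xty rt]; apply/eqP/negPn/negP => zt.
  have btw u v : x < u < y -> x < v < y -> root L u -> root L v -> u < v -> False.
    move=> /andP[xu _] /andP[_ vy] ru rv uv.
    have [c /andP[uc cv] /odd_mup_root rc] := rolle_odd L0 uv ru rv.
    have xcy : x < c < y by rewrite (lt_trans xu uc) (lt_trans cv vy).
    by have := nr c (I0xy c xcy) xcy; rewrite rc.
  by move: zt; rewrite neq_lt => /orP[/btw|/btw]; apply.
have [E [Z [[E1 dL _ gapZ sepZ] _]]] := crit_structure.
have inEZ z : I0 z -> root L^`() z -> z \in E \/ z \in Z.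
  move=> Iz; rewrite dL rootZ ?lead_coef_eq0 // root_prod_XsubC !mem_cat.
  by case/or3P=> [||/Y_notI0//]; [by left|by right].
have neq z t : I0 z -> z \in s -> root L^`() t -> z != t.
  move=> Iz zs rt; apply: contraTneq rt => <-.
  by apply: zero_not_crit (allP s_root _ zs); apply: I0K.
have one a b : a \in s -> b \in s -> {in s, forall t, ~~ (a < t < b)} ->
    a < x < b -> a < y < b -> False.
  move=> sa sb nsab axb ayb; move: xy; rewrite (_ : x = y) ?ltxx //.
  have [Ia Ib] := (s_I0 sa, s_I0 sb).
  apply: (crit_between_zeros_unique Ia Ib) => //; try exact: (allP s_root).
  move=> t atb; apply/negP => rt; have := nsab t (mem_zeros (I0_conv Ia Ib atb) rt).
  by rewrite atb.
have [xE|/gapZ[a [b [sa sb /andP[ax xb] nsab]]]] := inEZ x Ix rx; last first.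
  have [yb|yb|yb] := ltgtP y b.
  - by case: (one a b) => //; apply/andP; split=> //; apply: lt_trans xy.
  - by exists b; [rewrite xb | apply: (allP s_root)].
  - by have := neq b y (s_I0 sb) sb ry; rewrite yb eqxx.
have [yE|/gapZ[a [b [sa sb /andP[ay yb] nsab]]]] := inEZ y Iy ry.
  by case: E E1 xE yE {dL inEZ} => [|e [|//]] // _; rewrite !inE => /eqP xe /eqP ye;
    move: xy; rewrite xe ye ltxx.
have [ax|ax|ax] := ltgtP x a.
- by exists a; [rewrite ax | apply: (allP s_root)].
- by case: (one a b) => //; apply/andP; split=> //; apply: lt_trans xy yb.
- by have := neq a x (s_I0 sa) sa rx; rewrite ax eqxx.
Qed.

End Extremal.

(** * First-order optimality derived from minimality of the Sobolev norm *)

Section Variation.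
Variable R : realType.
Implicit Types (mu : {finite_measure set (measurableTypeR R) -> \bar R}).
Implicit Types (D : set R) (P Q q : {poly R}) (e p x y a b : R).

(* A first-order expansion with remainder of order [e `^ p], uniform in [a] and [b];
   it replaces differentiation under the integral sign. *)
Lemma perturbed_powR p e a b : 1 < p -> 0 < e -> 0 <= b * a ->
  `|a - e * b| `^ p + e * (`|a| `^ (p - 1) * `|b|) <= `|a| `^ p + 2 * e `^ p * `|b| `^ p.
Proof.
move=> p1 e0 ba0.
have p0 : 0 <= p by lra.
have p10 : 0 <= p - 1 by lra.
have powS u : 0 <= u -> u `^ p = u `^ (p - 1) * u.
  move=> u0; have [->|un0] := eqVneq u 0; first by rewrite powR0 ?mulr0 //; lra.
  by rewrite -[X in _ * X](powRr1 u0) -powRD ?un0 ?implybT //; congr (_ `^ _); ring.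
wlog [a0 b0] : a b ba0 / 0 <= a /\ 0 <= b.
  move=> wl; have [|] := lerP 0 a => a0; have [|] := lerP 0 b => b0.
  - exact: wl.
  - have -> : a = 0 by apply/eqP; rewrite eq_le a0 andbT; nra.
    have := wl 0 (- b); rewrite !sub0r mulrN opprK normrN normr0 mulr0 => /(_ (lexx _)).
    by rewrite normrN; apply; split=> //; lra.
  - have -> : b = 0 by apply/eqP; rewrite eq_le b0 andbT; nra.
    have := wl (- a) 0; rewrite !mulr0 !subr0 normrN mul0r => /(_ (lexx _)); apply;
        split=> //; lra.
  - have := wl (- a) (- b); rewrite mulrNN ba0 !normrN => /(_ isT).
    rewrite (_ : - a - e * - b = - (a - e * b)); last by ring.
    by rewrite normrN; apply; split; lra.
rewrite (ger0_norm a0) (ger0_norm b0) -mulrA -(powRM p (ltW e0) b0).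
have eb0 : 0 <= e * b by rewrite mulr_ge0 // ltW.
have [eba|aeb] := lerP (e * b) a.
  have h : 0 <= a - e * b by lra.
  rewrite (powS _ h) (powS a) //.
  have : (a - e * b) `^ (p - 1) <= a `^ (p - 1).
    by apply: ge0_ler_powR; rewrite ?nnegrE //; lra.
  have := powR_ge0 (e * b) p; have := powR_ge0 a (p - 1).
  move: (_ `^ _) (_ `^ _) (_ `^ _) => A B C; nra.
have h : 0 <= e * b - a by lra.
have h1 : (e * b - a) `^ p <= (e * b) `^ p.
  by apply: ge0_ler_powR; rewrite ?nnegrE //; lra.
have h2 : e * (a `^ (p - 1) * b) <= (e * b) `^ p.
  rewrite (powS (e * b)) // mulrCA ler_wpM2r //.
  by apply: ge0_ler_powR; rewrite ?nnegrE //; lra.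
have := powR_ge0 a p; lra.
Qed.

Lemma normc_horner_complexify Q x :
  ComplexField.Normc.normc (complexify Q).[x%:C] = `|Q.[x]|.
Proof. by rewrite /complexify horner_map /= expr0n /= addr0 sqrtr_sqr. Qed.

Lemma measurable_norm_poly D P :
  measurable_fun (D : set (measurableTypeR R)) (fun x => `|P.[x]|).
Proof. by apply: measurableT_comp => //; exact: measurable_poly. Qed.

Lemma measurable_norm_poly_powR D P r :
  measurable_fun (D : set (measurableTypeR R)) (fun x => `|P.[x]| `^ r).
Proof.
apply: (@measurableT_comp _ _ _ _ _ _ (@powR R ^~ r)); first exact: measurable_powR.
exact: measurable_norm_poly.
Qed.

Lemma Lfun_integral_lty mu D p P : 0 < p -> measurable D -> horner P \in Lfun mu p%:E ->
  (\int[mu]_(x in D) (`|P.[x]| `^ p)%:E < +oo)%E.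
Proof.
move=> p0 mD /sub_Lfun_finLfun; rewrite inE /= /finite_norm => fin.
apply: (@le_lt_trans _ _ (\int[mu]_x (`|P.[x]| `^ p)%:E)%E).
  apply: ge0_subset_integral => //.
  by apply/measurable_EFinP; exact: measurable_norm_poly_powR.
have := poweR_lty p fin; rewrite poweR_Lnorm ?gt_eqF //.
Qed.

(** Kept in additive form, the inequality compares integrals of nonnegative functions and needs no
    integrability. *)
Lemma integral_perturbed mu D p P q e : 1 < p -> 0 < e -> measurable D ->
    (forall x, D x -> 0 <= (q * P).[x]) ->
  (\int[mu]_(x in D) (`|(P - e *: q).[x]| `^ p)%:E
    + e%:E * \int[mu]_(x in D) (`|P.[x]| `^ (p - 1) * `|q.[x]|)%:E
   <= \int[mu]_(x in D) (`|P.[x]| `^ p)%:E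
    + (2 * e `^ p)%:E * \int[mu]_(x in D) (`|q.[x]| `^ p)%:E)%E.
Proof.
move=> p1 e0 mD qP.
have mpow (Q : {poly R}) r : measurable_fun D (fun x => `|Q.[x]| `^ r).
  exact: measurable_norm_poly_powR.
have mh : measurable_fun D (fun x => `|P.[x]| `^ (p - 1) * `|q.[x]|).
  by apply: measurable_funM => //; exact: measurable_norm_poly.
have h0 x : 0 <= `|P.[x]| `^ (p - 1) * `|q.[x]| by rewrite mulr_ge0 ?powR_ge0.
have e2 : 0 <= 2 * e `^ p by rewrite mulr_ge0 ?powR_ge0.
have mE (f : R -> R) : measurable_fun D f -> measurable_fun D (fun x => (f x)%:E).
  by move=> mf; apply/measurable_EFinP.
have mZ k (f : R -> R) : measurable_fun D f ->
    measurable_fun D (fun x => k%:E * (f x)%:E)%E.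
  by move=> mf; apply: (mE (fun x => k * f x)); apply: measurable_funM.
have p_ge0 (Q : {poly R}) x : D x -> (0 <= (`|Q.[x]| `^ p)%:E)%E.
  by move=> _; rewrite lee_fin powR_ge0.
have he_ge0 x : D x -> (0 <= e%:E * (`|P.[x]| `^ (p - 1) * `|q.[x]|)%:E)%E.
  by move=> _; rewrite -EFinM lee_fin mulr_ge0 // ltW.
have q_ge0 x : D x -> (0 <= (2 * e `^ p)%:E * (`|q.[x]| `^ p)%:E)%E.
  by move=> _; rewrite -EFinM lee_fin mulr_ge0 // powR_ge0.
have hE_ge0 x : D x -> (0 <= (`|P.[x]| `^ (p - 1) * `|q.[x]|)%:E)%E.
  by move=> _; rewrite lee_fin.
rewrite -!ge0_integralZl_EFin ?(ltW e0) //; try exact: mE; try exact: p_ge0.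
rewrite -!ge0_integralD //; try exact: mE; try exact: mZ; try exact: p_ge0;
    try exact: q_ge0;
  try exact: he_ge0.
apply: ge0_le_integral => //.
- by move=> x Dx; apply: adde_ge0; [exact: p_ge0|exact: he_ge0].
- by apply: (mE (fun x => _ + e * _)); apply: measurable_funD => //; apply: measurable_funM.
- by apply: (mE (fun x => _ + _ * _)); apply: measurable_funD => //; apply: measurable_funM.
- move=> x Dx; rewrite -!EFinM -!EFinD lee_fin hornerD hornerN hornerZ.
  by apply: perturbed_powR => //; rewrite -hornerM qP.
Qed.

(** Near [x] both factors exceed half their values at [x], on an open set of positive measure. A
    real lower bound [k] is enough, so finiteness of the integral need not be established. *)
Lemma integral_pairing_gt0 mu D p P q x : 1 < p -> measurable D ->
    msupport mu x -> D° x -> P.[x] != 0 -> q.[x] != 0 ->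
  exists2 k, 0 < k & (k%:E <= \int[mu]_(x in D) (`|P.[x]| `^ (p - 1) * `|q.[x]|)%:E)%E.
Proof.
move=> p1 mD supp Dx Px qx.
pose big (Q : {poly R}) := [set y | `|Q.[x]| / 2 < `|Q.[y]|].
have big_open Q : open (big Q).
  apply: (@open_comp _ _ (fun y : R => `|Q.[y]|) [set t | `|Q.[x]| / 2 < t]).
    move=> y _; apply: (@continuous_comp _ _ _ (horner Q) Num.norm).
      exact: continuous_horner.
    exact: norm_continuous.
  exact: open_gt.
have big_x (Q : {poly R}) : Q.[x] != 0 -> big Q x.
  by rewrite /big /= -normr_gt0; lra.
pose U : set R := D° `&` (big P `&` big q).
have oU : open U by apply: openI; [exact: open_interior|exact: openI].
have Ux : U x by split=> //; split; exact: big_x.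
have mU : measurable (U : set (measurableTypeR R)) by exact: open_measurable.
have UD : U `<=` D by move=> y [/interior_subset].
have muU : (0 < mu U)%E by exact: supp.
have muUfin : mu U \is a fin_num by exact: fin_num_measure.
pose c := (`|P.[x]| / 2) `^ (p - 1) * (`|q.[x]| / 2).
have c0 : 0 < c by rewrite mulr_gt0 ?powR_gt0 ?divr_gt0 ?normr_gt0.
exists (c * fine (mu U)).
  by rewrite mulr_gt0 // fine_gt0 // muU /= ltey_eq muUfin.
rewrite EFinM fineK // -(integral_cst mu mU).
have mh (A : set R) : measurable_fun (A : set (measurableTypeR R))
    (fun y => (`|P.[y]| `^ (p - 1) * `|q.[y]|)%:E).
  apply/measurable_EFinP/measurable_funM; first exact: measurable_norm_poly_powR.
  exact: measurable_norm_poly.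
have h0 y : (0 <= (`|P.[y]| `^ (p - 1) * `|q.[y]|)%:E)%E.
  by rewrite lee_fin mulr_ge0 ?powR_ge0.
apply: (@le_trans _ _ (\int[mu]_(y in U) (`|P.[y]| `^ (p - 1) * `|q.[y]|)%:E)%E);
    last first.
  exact: ge0_subset_integral.
apply: ge0_le_integral => //; first by move=> y _; rewrite lee_fin ltW.
move=> y [_ [Py qy]]; rewrite lee_fin ler_pM ?powR_ge0 //.
- by apply: ge0_ler_powR; rewrite ?nnegrE //; [lra|exact: ltW].
- exact: ltW.
Qed.

Lemma sobolev_norm_complexify mu0 mu1 D0 D1 p P :
  sobolev_norm p mu0 mu1 D0 D1 (complexify P) =
  ((\int[mu0]_(x in D0) (`|P.[x]| `^ p)%:E + \int[mu1]_(x in D1) (`|P^`().[x]| `^ p)%:E)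
   `^ p^-1)%E.
Proof.
have normE (Q : {poly R}) :
    (fun x : R => (ComplexField.Normc.normc (complexify Q).[x%:C] `^ p)%:E) =
    (fun x : R => (`|Q.[x]| `^ p)%:E).
  by apply/funext => x; rewrite normc_horner_complexify.
have derivE : (complexify P)^`() = complexify P^`() by rewrite /complexify deriv_map.
by rewrite /sobolev_norm derivE !normE.
Qed.

Lemma poweR_inv_le p x y : 0 < p -> 0 <= x -> 0 <= y ->
  (x%:E `^ p^-1 <= y%:E `^ p^-1)%E -> x <= y.
Proof.
move=> p0 x0 y0; rewrite !poweR_EFin lee_fin => le.
have : (x `^ p^-1) `^ p <= (y `^ p^-1) `^ p.
  by apply: ge0_ler_powR; rewrite ?nnegrE ?powR_ge0 // ltW.
by rewrite -!powRrM mulVf ?gt_eqF // !powRr1.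
Qed.

Lemma no_descent_direction mu0 mu1 D0 D1 p n L q x : 1 < p ->
    measurable D0 -> measurable D1 ->
    (forall P, horner P \in Lfun mu0 p%:E) -> (forall P, horner P \in Lfun mu1 p%:E) ->
    monic_extremal p mu0 mu1 D0 D1 n L ->
    (size q <= n)%N -> msupport mu0 x -> D0° x -> (q * L).[x] != 0 ->
    (forall x, D0 x -> 0 <= (q * L).[x]) -> (forall x, D1 x -> 0 <= (q^`() * L^`()).[x]) ->
  False.
Proof.
move=> p1 mD0 mD1 Lp0 Lp1 [Lm sL Lmin] sq supp Dx; rewrite hornerM mulf_eq0 negb_or
    => /andP[qx Lx] pos0 pos1.
have p0 : 0 < p by lra.
have [k k_gt0 kle] := integral_pairing_gt0 p1 mD0 supp Dx Lx qx.
pose I0 (P : {poly R}) := (\int[mu0]_(x in D0) (`|P.[x]| `^ p)%:E)%E.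
pose I1 (P : {poly R}) := (\int[mu1]_(x in D1) (`|P.[x]| `^ p)%:E)%E.
have I0_ge0 P : (0 <= I0 P)%E by apply: integral_ge0 => y _; rewrite lee_fin powR_ge0.
have I1_ge0 P : (0 <= I1 P)%E by apply: integral_ge0 => y _; rewrite lee_fin powR_ge0.
have I0_fin P : I0 P \is a fin_num by rewrite ge0_fin_numE // Lfun_integral_lty.
have I1_fin P : I1 P \is a fin_num by rewrite ge0_fin_numE // Lfun_integral_lty.
have step0 e : 0 < e -> (I0 (L - e *: q)%R + (e * k)%:E <= I0 L + (2 * e `^ p)%:E * I0 q)%E.
  move=> e0; apply: le_trans (integral_perturbed mu0 p1 e0 mD0 pos0).
  by rewrite leeD2l // EFinM lee_pmul2l // lte_fin.
have step1 e : 0 < e -> (I1 (L - e *: q)^`()%R <= I1 L^`() + (2 * e `^ p)%:E * I1 q^`())%E.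
  move=> e0; rewrite derivB derivZ; apply: le_trans (integral_perturbed mu1 p1 e0 mD1 pos1).
  rewrite leeDl // mule_ge0 ?lee_fin ?(ltW e0) //.
  by apply: integral_ge0 => y _; rewrite lee_fin mulr_ge0 ?powR_ge0.
have minI P : P \is monic -> size P = n.+1 ->
    ((I0 L + I1 L^`()) `^ p^-1 <= (I0 P + I1 P^`()) `^ p^-1)%E.
  move=> Pm sP; have := Lmin (complexify P).
  by rewrite !sobolev_norm_complexify /complexify map_monic size_map_poly; apply.
clearbody I0 I1.
pose N P := fine (I0 P) + fine (I1 P^`()).
have NE P : (I0 P + I1 P^`())%E = (N P)%:E by rewrite /N EFinD !fineK.
have N_ge0 P : 0 <= N P by rewrite -lee_fin -NE adde_ge0.
have minN P : P \is monic -> size P = n.+1 -> N L <= N P.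
  by move=> Pm sP; have := minI P Pm sP; rewrite !NE; exact: poweR_inv_le.
have key e : 0 < e -> e * k <= 2 * e `^ p * N q.
  move=> e0; have sLq : (size (- (e *: q)) < size L)%N.
    by rewrite size_polyN sL ltnS (leq_trans (size_scale_leq _ _)).
  have min : N L <= N (L - e *: q).
    by apply: minN; rewrite ?monicE ?lead_coefDl // ?size_polyDl // -monicE.
  have := step0 e e0; have := step1 e e0; move: min.
  rewrite -(fineK (I0_fin (L - e *: q))) -(fineK (I0_fin L)) -(fineK (I0_fin q)).
  rewrite -(fineK (I1_fin (L - e *: q)^`())) -(fineK (I1_fin L^`())) 
    -(fineK (I1_fin q^`())).
  rewrite -!EFinM -!EFinD !lee_fin /N mulrDr.
  lra.
pose t := k / (2 * N q + 1).
have Nq1 : 0 < 2 * N q + 1 by have := N_ge0 q; lra.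
have t_gt0 : 0 < t by rewrite divr_gt0.
pose e := t `^ (p - 1)^-1.
have e_gt0 : 0 < e by rewrite powR_gt0.
have et : e `^ (p - 1) = t.
  by rewrite /e -powRrM mulVf ?subr_eq0 ?gt_eqF // powRr1 // ltW.
have ep : e `^ p = e * t.
  rewrite -et -[X in _ = X * _](powRr1 (ltW e_gt0)) -powRD;
      last by rewrite (gt_eqF e_gt0) implybT.
  by congr (_ `^ _); ring.
have := key e e_gt0; rewrite ep.
have -> : 2 * (e * t) * N q = e * (2 * t * N q) by ring.
rewrite ler_pM2l // => le_k.
have tE : t * (2 * N q + 1) = k by rewrite divfK // gt_eqF.
by move: le_k; rewrite -tE; nra.
Qed.

End Variation.

(** * Interiors, convex hulls and zero counts on the real line *)

Section RealSets.
Variable R : realType.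
Implicit Types (A D : set R) (P Q : {poly R}) (a b c t u v x y z : R).

Lemma interval_interior D u v c : is_interval D -> D u -> D v -> u < c < v -> D° c.
Proof.
move=> iD Du Dv /andP[uc cv].
have : nbhs c [set` `]u, v[] by apply: near_in_itvoo; rewrite in_itv /= uc cv.
apply: filterS => y /=; rewrite in_itv /= => /andP[uy yv].
by apply: (iD u v) => //; rewrite !ltW.
Qed.

Lemma interior_left D x : D° x -> exists2 a, a < x & D° a.
Proof.
move=> Dx; have : nbhs x D° by apply: open_nbhs_nbhs; split=> //; exact: open_interior.
move=> /nbhs_ballP[e /= e0 be]; exists (x - e / 2); first by lra.
by apply: be; rewrite /ball /= opprB addrC subrK ger0_norm; lra.
Qed.

Lemma interior_right D x : D° x -> exists2 a, x < a & D° a.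
Proof.
move=> Dx; have : nbhs x D° by apply: open_nbhs_nbhs; split=> //; exact: open_interior.
move=> /nbhs_ballP[e /= e0 be]; exists (x + e / 2); first by lra.
by apply: be; rewrite /ball /= opprD addNKr normrN ger0_norm; lra.
Qed.

Lemma convex_is_interval (A : set R) : @convex_set R R^o A -> is_interval A.
Proof.
move=> cA; apply/is_intervalPlt => x y Ax Ay z /andP[xz zy].
have xy : 0 < y - x by lra.
have l0 : 0 <= (y - z) / (y - x) by rewrite divr_ge0 //; lra.
have l1 : (y - z) / (y - x) <= 1 by rewrite ler_pdivrMr //; lra.
have := cA x y (Itv01 l0 l1); rewrite !inE => /(_ Ax Ay).
suff -> : @conv R (@convex_lmodType R R^o) (Itv01 l0 l1) x y = z by [].
change ((y - z) / (y - x) * x + (1 - (y - z) / (y - x)) * y = z :> R).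
by field; lra.
Qed.

Lemma is_interval_convex (A : set R) : is_interval A -> @convex_set R R^o A.
Proof.
move=> iA x y l; rewrite !inE => Ax Ay.
have l1 : l%:num <= 1 by [].
have l0 : 0 <= l%:num by [].
change (A (l%:num * x + (1 - l%:num) * y)).
have [xy|yx] := leP x y.
  by apply: (iA x y) => //; apply/andP; split; nra.
by apply: (iA y x) => //; apply/andP; split; nra.
Qed.

Lemma sub_convex_hull A : A `<=` convex_hull A.
Proof. exact: sub_gen_smallest. Qed.

Lemma convex_hull_interval A : is_interval (convex_hull A).
Proof.
move=> x y Cx Cy z xzy B [/= cB AB].
by apply: (convex_is_interval cB (Cx _ _) (Cy _ _) xzy).
Qed.

Lemma convex_hull_min A B : is_interval B -> A `<=` B -> convex_hull A `<=` B.
Proof. by move=> iB AB x; apply; split=> //; exact: is_interval_convex. Qed.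

Lemma convex_hull_lt A a : (convex_hull A)° a -> exists2 u, A u & u < a.
Proof.
move=> Ca; apply: contrapT => nou.
have [b ba /interior_subset Cb] := interior_left Ca.
have : [set x | a <= x] b.
  apply: (convex_hull_min _ _ Cb).
    by move=> x y ax _ z /andP[xz _]; exact: le_trans xz.
  by move=> x Ax /=; rewrite leNgt; apply/negP => xa; apply: nou; exists x.
by rewrite /= leNgt ba.
Qed.

Lemma convex_hull_gt A a : (convex_hull A)° a -> exists2 u, A u & a < u.
Proof.
move=> Ca; apply: contrapT => nou.
have [b ba /interior_subset Cb] := interior_right Ca.
have : [set x | x <= a] b.
  apply: (convex_hull_min _ _ Cb).
    by move=> x y _ ya z /andP[_ zy]; exact: le_trans ya.
  by move=> x Ax /=; rewrite leNgt; apply/negP => xa; apply: nou; exists x.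
by rewrite /= leNgt ba.
Qed.

(** Among three points of [A] that are not roots, the middle one is interior to the interval [D].
    This yields a support point with a whole neighbourhood inside [D]. *)
Lemma infinite_interior_nonroot A D P : is_interval D -> A `<=` D -> infinite_set A ->
  P != 0 -> exists x, [/\ A x, D° x & P.[x] != 0].
Proof.
move=> iD AD infA P0.
have finP : finite_set [set x | root P x].
  apply: (@sub_finite_set _ _ [set` rootsR P]); last exact: finite_seq.
  by move=> x /=; rewrite -(roots_on_rootsR P0) inE.
have [B BA B3] := infinite_set_fset 3 (infinite_setD infA finP).
have sB : sorted <%R (sort <=%R (enum_fset B)) by rewrite sort_lt_sorted fset_uniq.
have inB x : x \in sort <=%R (enum_fset B) -> A x /\ ~ root P x.
  by rewrite mem_sort => xB; have [] := BA x xB.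
have := B3; rewrite -(size_sort <=%R).
case: (sort _ _) sB inB => [|x [|y [|z s]]] // /and3P[xy yz _] inB _.
have [/AD Dx _] := inB x (mem_head _ _).
have [|Ay Py] := inB y; first by rewrite !inE eqxx orbT.
have [|/AD Dz _] := inB z; first by rewrite !inE eqxx !orbT.
exists y; split=> //; last exact/negP.
by apply: (interval_interior iD Dx Dz); rewrite xy.
Qed.

Lemma num_odd_zerosE P A s : uniq s -> (forall x, x \in s <-> A x /\ odd (mup x P)) ->
  num_odd_zeros P A = size s.
Proof.
move=> us sE; rewrite /num_odd_zeros.
have -> : [set x | A x /\ odd (mup x P)] = [set` [fset x in s]%fset].
  by apply/seteqP; split=> x /=; rewrite !inE /= => /sE.
by rewrite set_fsetK card_fseq undup_id.
Qed.

Lemma num_zeros_le1 P A : P != 0 -> (forall x, A x -> root P x -> mup x P = 1%N) ->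
    (forall x y, A x -> A y -> root P x -> root P y -> x = y) ->
  (num_zeros P A <= 1)%N.
Proof.
move=> P0 simple unique; rewrite /num_zeros.
have [[x [Ax rx]]|none] := pselect (exists x, A x /\ root P x); last first.
  rewrite fsbig1 // => x Ax; apply: mupNroot; apply/negP => rx.
  by apply: none; exists x.
rewrite -(@fsbig_widen _ _ _ _ [set x]); first by rewrite fsbig_set1 simple.
  by move=> y /= ->.
move=> y [/= Ay yx]; apply: mupNroot; apply/negP => ry.
by apply: yx; apply: unique.
Qed.

End RealSets.

(** * Relative position of the two intervals *)

Section TwoIntervals.
Variables (R : realType) (D0 D1 : set R).
Hypothesis D0_itv : is_interval D0.
Hypothesis D1_itv : is_interval D1.
Hypothesis D01 : D0° `&` D1° = set0.
Hypothesis D1_pt : forall a : R, D1 = [set a] -> ~ (D0°) a.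
Implicit Types (a b c t u v x y z : R).

Lemma interiors_disjoint x : D0° x -> D1° x -> False.
Proof. by move=> I0x I1x; have : (D0° `&` D1°) x by []; rewrite D01. Qed.

Lemma interior_itv x y c : D0° x -> D0° y -> x < c < y -> D0° c.
Proof. by move=> /interior_subset Dx /interior_subset Dy; exact: interval_interior. Qed.

(** If [D1] met [D0°] at [x], it would contain a second point [t]; points close to [x] on the side
    of [t] would be interior to both intervals. *)
Lemma interior_disjoint x : D0° x -> D1 x -> False.
Proof.
move=> I0x D1x.
have [t D1t tx] : exists2 t, D1 t & t != x.
  apply: contrapT => noy; apply: (D1_pt _ I0x); apply/seteqP; split=> [y D1y /=|y /= ->//].
  by apply/eqP/negPn/negP => yx; apply: noy; exists y.
have [xt|xt|xt] := ltgtP x t; last by rewrite xt eqxx in tx.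
- have [b xb I0b] := interior_right I0x.
  pose c := (x + Num.min t b) / 2.
  have [xc ct cb] : [/\ x < c, c < t & c < b].
    by rewrite /c; case: (leP t b) => ?; split; lra.
  apply: (@interiors_disjoint c).
    by apply: (interior_itv I0x I0b); rewrite xc.
  by apply: (interval_interior D1_itv D1x D1t); rewrite xc.
- have [b bx I0b] := interior_left I0x.
  pose c := (x + Num.max t b) / 2.
  have [xc ct cb] : [/\ c < x, t < c & b < c].
    by rewrite /c; case: (leP t b) => ?; split; lra.
  apply: (@interiors_disjoint c).
    by apply: (interior_itv I0b I0x); rewrite xc cb.
  by apply: (interval_interior D1_itv D1t D1x); rewrite ct.
Qed.

Lemma interval_sides : (forall x t, D0° x -> D1 t -> x < t) \/
  (forall x t, D0° x -> D1 t -> t < x).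
Proof.
have [[x0 [t0 [I0x0 D1t0 xt0]]]|none] := pselect (exists x t, [/\ D0° x, D1 t & x < t]).
- left=> x t I0x D1t; rewrite ltNge le_eqVlt; apply/negP => /predU1P[tx|tx].
    by apply: (interior_disjoint I0x); rewrite -tx.
  have [x0t|tx0] := leP x0 t.
    apply: (@interior_disjoint t) => //; move: x0t; rewrite le_eqVlt => /predU1P[<-//|x0t].
    by apply: (interior_itv I0x0 I0x); rewrite x0t.
  by apply: (interior_disjoint I0x0); apply: (D1_itv D1t D1t0); rewrite !ltW.
- right=> x t I0x D1t; rewrite ltNge le_eqVlt; apply/negP => /predU1P[xt|xt].
    by apply: (interior_disjoint I0x); rewrite xt.
  by apply: none; exists x, t.
Qed.

(** The separator is the end point of [D0°] facing [D1]. It bounds [D0°] on one side and [D1] on the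
    other, and an open set does not contain its own bound. *)
Lemma interval_separator : D0° !=set0 -> (exists t, D1 t) ->
  exists c, [/\ ~ D0° c, ~ D1° c &
    forall x t, D0° x -> D1 t -> (x - c) * (t - c) <= 0].
Proof.
move=> [x0 I0x0] [t0 D1t0]; have [sd|sd] := interval_sides.
- have ub t : D1 t -> ubound D0° t by move=> D1t x I0x; apply/ltW/sd.
  have sup0 : has_sup D0° by split; [exists x0|exists t0; exact: ub].
  have xc x : D0° x -> x <= sup D0° by move=> I0x; apply: ub_le_sup => //; case: sup0.
  have ct t : D1 t -> sup D0° <= t by move=> D1t; apply: ge_sup; [exists x0|exact: ub].
  exists (sup D0°); split.
  + by move=> /interior_right[b cb /xc]; rewrite leNgt cb.
  + by move=> /interior_left[b cb /interior_subset/ct]; rewrite leNgt cb.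
  + by move=> x t /xc ? /ct ?; nra.
- have lb t : D1 t -> lbound D0° t by move=> D1t x I0x; apply/ltW/sd.
  have inf0 : has_inf D0° by split; [exists x0|exists t0; exact: lb].
  have xc x : D0° x -> inf D0° <= x by move=> I0x; apply: ge_inf => //; case: inf0.
  have ct t : D1 t -> t <= inf D0° by move=> D1t; apply: lb_le_inf; [exists x0|exact: lb].
  exists (inf D0°); split.
  + by move=> /interior_left[b cb /xc]; rewrite leNgt cb.
  + by move=> /interior_right[b cb /interior_subset/ct]; rewrite leNgt cb.
  + by move=> x t /xc ? /ct ?; nra.
Qed.

(* If [D1] had an interior point between [a] and [b], it would lie inside
   [[a, b]], and [D0] would have points on both sides of it. *)
Lemma hull_minus_interior_conv a b c : let C := convex_hull (D0 `|` D1) in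
  C° a -> ~ D1° a -> C° b -> ~ D1° b -> a < c < b -> ~ D1° c.
Proof.
move=> C Ca I1a Cb I1b /andP[ac cb] I1c; have D1c := interior_subset I1c.
have [u [D0u|D1u] ua] := convex_hull_lt Ca; last first.
  by apply: I1a; apply: (interval_interior D1_itv D1u D1c); rewrite ua.
have [v [D0v|D1v] bv] := convex_hull_gt Cb; last first.
  by apply: I1b; apply: (interval_interior D1_itv D1c D1v); rewrite cb.
apply: (@interiors_disjoint c) => //; apply: (interval_interior D0_itv D0u D0v).
by rewrite (lt_trans ua ac) (lt_trans cb bv).
Qed.

End TwoIntervals.

(** * Complex zeros of the derivative, and assembly of the four parts *)

Lemma complexify_uniq_roots (R : realType) (P : {poly R}) W (z : R[i]) :
    P != 0 -> uniq W -> P = lead_coef P *: \prod_(w <- W) ('X - w%:P) ->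
    root (complexify P) z ->
  mup z (complexify P) = 1%N /\ exists2 x : R, root P x & z = x%:C.
Proof.
move=> P0 uW defP; have k0 : (lead_coef P)%:C != 0.
  by rewrite fmorph_eq0 lead_coef_eq0.
have -> : complexify P =
    (lead_coef P)%:C *: \prod_(w <- map (real_complex R) W) ('X - w%:P).
  rewrite {1}defP /complexify map_polyZ rmorph_prod big_map; congr (_ *: _).
  by apply: eq_bigr => w _; rewrite rmorphB /= map_polyX map_polyC.
rewrite rootZ // root_prod_XsubC mupZ // mu_prod_XsubC.
have uWC : uniq (map (real_complex R) W) by rewrite map_inj_uniq //; apply: fmorph_inj.
move=> zW; rewrite count_uniq_mem // zW; split=> //.
have /mapP[x xW ->] := zW; exists x => //.
by rewrite defP rootZ ?lead_coef_eq0 // root_prod_XsubC.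
Qed.

Theorem theorem1 (R : realType) (p : R) (hp : 1 < p)
    (mu0 mu1 : {finite_measure set (measurableTypeR R) -> \bar R})
    (D0 D1 : set R)
    (D0_itv : is_interval D0) (D0_closed : closed D0)
    (D1_itv : is_interval D1) (D1_closed : closed D1)
    (mu0_D0 : msupport mu0 `<=` D0) (mu1_D1 : msupport mu1 `<=` D1)
    (mu0_inf : infinite_set (msupport mu0))
    (poly_Lp0 : forall Q : {poly R}, horner Q \in Lfun mu0 p%:E)
    (poly_Lp1 : forall Q : {poly R}, horner Q \in Lfun mu1 p%:E)
    (D0_npt : forall a : R, D0 <> [set a])
    (D01 : D0° `&` D1° = set0)
    (D1_pt : forall a : R, D1 = [set a] -> ~ (D0°) a) :
  let C := convex_hull (D0 `|` D1) in
  let gap := C° `\` (D0° `|` D1°) in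
  forall (n : nat) (L : {poly R}), monic_extremal p mu0 mu1 D0 D1 n L ->
  [/\ (1 <= n)%N ->
        (n.-1 <= num_odd_zeros L (D0°) + num_odd_zeros L^`() (D1°) <= n)%N /\
        (forall x : R, (D0°) x -> root L x -> mup x L = 1%N),
      (2 <= n)%N ->
        forall z : R[i], root (complexify L^`()) z ->
          mup z (complexify L^`()) = 1%N /\
          exists2 x : R, (C°) x & z = x%:C,
      (1 <= n)%N -> (num_zeros L gap <= 1)%N /\ (num_zeros L^`() gap <= 1)%N
    & (1 <= n)%N -> interlace L L^`() (D0°)].
Proof.
move=> C gap n L ext; have [Lm sL _] := ext.
have [->|n_gt0] := posnP n; first by split.
have L0 : L != 0 by rewrite monic_neq0.
have dL0 : L^`() != 0 by rewrite -size_poly_eq0 size_deriv sL -lt0n.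
have D0I0 (u v c : R) : D0 u -> D0 v -> u < c < v -> D0° c by apply: interval_interior.
have D1I1 (u v c : R) : D1 u -> D1 v -> u < c < v -> D1° c by apply: interval_interior.
have side := interval_sides D0_itv D1_itv D01 D1_pt.
have I0_ne : D0° !=set0.
  have [x [_ I0x _]] := infinite_interior_nonroot D0_itv mu0_D0 mu0_inf L0.
  by exists x.
have sep := interval_separator D0_itv D1_itv D01 D1_pt I0_ne.
(* [K] is [D0°] together with the gap, so a single simplicity statement serves both the first and
   the third part. *)
pose K := [set x | C° x /\ ~ D1° x].
have KI1 (x : R) : K x -> ~ D1° x by case.
have Kconv (a b c : R) : K a -> K b -> a < c < b -> ~ D1° c.
  by move=> [Ca I1a] [Cb I1b]; exact: (hull_minus_interior_conv D0_itv D1_itv D01 Ca).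
have CI0 (x : R) : D0° x -> C° x.
  by apply: interiorS; apply: subset_trans (@sub_convex_hull _ _); exact: subsetUl.
have CI1 (x : R) : D1° x -> C° x.
  by apply: interiorS; apply: subset_trans (@sub_convex_hull _ _); exact: subsetUr.
have I0K (x : R) : D0° x -> K x.
  by move=> I0x; split; [exact: CI0|move=> /(interiors_disjoint D01 I0x)].
have extr (q : {poly R}) : q != 0 -> (size q <= n)%N ->
    (forall x, D0 x -> 0 <= (q * L).[x]) ->
    (forall x, D1 x -> 0 <= (q^`() * L^`()).[x]) -> False.
  move=> q0 sq; have qL0 : q * L != 0 by rewrite mulf_neq0.
  have [x [sx I0x qLx]] := infinite_interior_nonroot D0_itv mu0_D0 mu0_inf qL0.
  apply: (no_descent_direction hp _ _ poly_Lp0 poly_Lp1 ext sq sx I0x qLx);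
    exact: is_interval_measurable.
have [s [ss ms]] := odd_zeros_seq D0° L0.
have [Y [sY mY]] := odd_zeros_seq D1° dL0.
have us : uniq s := sorted_uniq lt_trans ltxx ss.
have uY : uniq Y := sorted_uniq lt_trans ltxx sY.
have I0D0 (x : R) : D0° x -> D0 x := @interior_subset _ D0 x.
have I1D1 (x : R) : D1° x -> D1 x := @interior_subset _ D1 x.
have left0 := @interior_left R D0.
have simple (x : R) : K x -> root L x -> mup x L = 1%N.
  exact: (zeros_simple I0D0 I1D1 D0I0 D1I1 left0 side sep KI1 Kconv I0K n_gt0 Lm sL extr
      ss ms uY mY).
have gapK (x : R) : gap x -> [/\ K x, ~ D0° x & ~ D1° x].
  by move=> [Cx /not_orP[I0x I1x]].
split.
- move=> _; rewrite (num_odd_zerosE us ms) (num_odd_zerosE uY mY); split.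
    rewrite (odd_zeros_lower_bound I0D0 I1D1 D0I0 D1I1 left0 side sep n_gt0 Lm sL extr ss
        ms uY mY).
    by rewrite (odd_zeros_upper_bound D0I0 KI1 Kconv I0K n_gt0 Lm sL extr ss ms uY mY).
  by move=> x /I0K; exact: simple.
- move=> _ z rz.
  have [W uW dL] := crit_factor I0D0 I1D1 D0I0 D1I1 left0 side sep n_gt0 Lm sL extr ss ms
      uY mY.
  have [-> [x rx zx]] := complexify_uniq_roots dL0 uW dL rz; split=> //; exists x => //.
  have Citv := @convex_hull_interval R (D0 `|` D1).
  have [[a [b [sa sb axb]]]|/CI1 //|[y [t [sy D1t sgn]]]] :=
    crit_location I0D0 I1D1 D0I0 D1I1 left0 side sep KI1 Kconv I0K n_gt0 Lm sL extr ss ms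
        uY mY rx.
    have /I0D0 D0a : D0° a by case/ms: sa.
    have /I0D0 D0b : D0° b by case/ms: sb.
    by apply: CI0; exact: D0I0 axb.
  (* Here the critical point lies strictly between a point of [D0] and a point of [D1], which puts
     it in the interior of the hull. *)
  have Cy : C y by apply: sub_convex_hull; left; apply: I0D0; case/ms: sy.
  have Ct : C t by apply: sub_convex_hull; right.
  have [yx|xy] := ltP y x.
    by apply: (interval_interior Citv Cy Ct); rewrite yx /=; nra.
  have {}xy : x < y.
    by rewrite lt_neqAle xy andbT; apply: contraTneq sgn => ->; rewrite subrr mul0r ltxx.
  by apply: (interval_interior Citv Ct Cy); rewrite xy andbT; nra.
- move=> _; split; apply: num_zeros_le1 => //.
  + by move=> x /gapK[Kx _ _]; exact: simple.
  + move=> x y /gapK[Kx I0x _] /gapK[Ky I0y _].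
    exact: (gap_zero_unique I0D0 I1D1 D0I0 D1I1 left0 side sep KI1 Kconv I0K n_gt0 Lm sL
        extr ss ms uY mY Kx Ky I0x I0y).
  + move=> x _.
    exact: (crit_simple I0D0 I1D1 D0I0 D1I1 left0 side sep n_gt0 Lm sL extr ss ms uY mY).
  + move=> x y /gapK[_ I0x I1x] /gapK[_ I0y I1y].
    exact: (gap_crit_unique I0D0 I1D1 D0I0 D1I1 left0 side sep n_gt0 Lm sL extr ss ms uY
        mY I0x I1x I0y I1y).
- move=> _; split=> x y [[Ix Iy xy rx ry] nr].
    exact: (interlace_zeros I0D0 I1D1 D0I0 D1I1 left0 side sep n_gt0 Lm sL extr ss ms uY
        mY Ix Iy xy rx ry nr).
  exact: (interlace_crit I0D0 I1D1 D0I0 D1I1 left0 side sep KI1 Kconv I0K n_gt0 Lm sL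
      extr ss ms uY mY Ix Iy xy rx ry nr).
Qed.
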